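(* Let $V$ and $W$ be optimal prefix-free machines, and let $f\colon\mathbb{N}\to\mathbb{N}$ be an order function. Then the following two conditions are equivalent: (i) There exists $c\in\mathbb{N}$ such that $\operatorname{dom}W$ is reducible to $\mathrm{Pf}(\Omega_V)$ in query size $f(n)+c$ (that is, in query size given by the function $n\mapsto f(n)+c$). (ii) There exists $c\in\mathbb{N}$ such that $n\le f(n)+c$ for all $n\in\mathbb{N}$.
   Context: $\{0,1\}^*$ is the set of finite binary strings and $|x|$ is the length of $x$. A prefix-free machine is a partial recursive function $F\colon\{0,1\}^*\to\{0,1\}^*$ whose domain $\operatorname{dom}F$ is prefix-free. A prefix-free machine $V$ is optimal if for each prefix-free machine $F$ there exists $d\in\mathbb{N}$ such that for every $p\in\operatorname{dom}F$ there is $q\in\operatorname{dom}V$ with $V(q)=F(p)$ and $|q|\le|p|+d$. $\Omega_V=\sum_{p\in\operatorname{dom}V}2^{-|p|}$. For a real $\alpha$ and $n\in\mathbb{N}$, $\alpha\!\upharpoonright_n\in\{0,1\}^*$ denotes the first $n$ bits of the base-two expansion of $\alpha-\lfloor\alpha\rfloor$ with infinitely many zeros, and $\mathrm{Pf}(\alpha)=\{\alpha\!\upharpoonright_n\mid n\in\mathbb{N}\}\subset\{0,1\}^*$. For $f\colon\mathbb{N}\to\mathbb{N}$ and $A,B\subset\{0,1\}^*$, $A$ is reducible to $B$ in query size $f$ if there exists an oracle deterministic Turing machine $M$ such that $A$ is Turing reducible to $B$ via $M$ and, on every input $x\in\{0,1\}^*$, $M$ only queries strings of length at most $f(|x|)$.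 An order function is a non-decreasing total recursive function $f\colon\mathbb{N}\to\mathbb{N}$ with $\lim_{n\to\infty}f(n)=\infty$. *)

(* Defs.v *)
From mathcomp Require Import all_boot all_order all_algebra.
From mathcomp Require Import all_classical all_reals all_analysis.
Set Implicit Arguments.
Unset Strict Implicit.
Unset Printing Implicit Defensive.
Import Order.TTheory GRing.Theory Num.Theory numFieldNormedType.Exports.

Local Open Scope classical_set_scope.
Local Open Scope nat_scope.

Inductive recfun : nat -> Type :=
| Zero n : recfun n
| Succ : recfun 1
| Proj n (i : 'I_n) : recfun n
| Comp m n (g : recfun m) (h : 'I_m -> recfun n) : recfun n
| PrimRec n (g : recfun n) (h : recfun n.+2) : recfun n.+1
| Mu n (g : recfun n.+1) : recfun n.

(* Graph of the function r with r 0 = u iff G u, and r k.+1 = v iff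
   H k (r k) v, where G and H are themselves graphs of partial functions. *)
Fixpoint primrec_graph (G : nat -> Prop) (H : nat -> nat -> nat -> Prop)
    (k : nat) (v : nat) : Prop :=
  if k is k'.+1 then exists2 u, primrec_graph G H k' u & H k' u v else G v.

(* [rec_graph e xs y] : the partial function denoted by [e] is defined at [xs]
   with value [y].  The recursion (resp. search) variable comes first; a search
   converges only if all the values before the first zero are defined. *)
Fixpoint rec_graph n (e : recfun n) : n.-tuple nat -> nat -> Prop :=
  match e in recfun n return n.-tuple nat -> nat -> Prop with
  | Zero _ => fun _ y => y = 0
  | Succ => fun xs y => y = (thead xs).+1
  | Proj _ i => fun xs y => y = tnth xs i
  | Comp m _ g h => fun xs y =>
      exists2 zs : m.-tuple nat,
        (forall i, rec_graph (h i) xs (tnth zs i)) & rec_graph g zs y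
  | PrimRec _ g h => fun xs y =>
      let ys := [tuple of behead xs] in
      primrec_graph (rec_graph g ys)
        (fun k u => rec_graph h [tuple of k :: u :: ys]) (thead xs) y
  | Mu _ g => fun xs y =>
      rec_graph g [tuple of y :: xs] 0 /\
      (forall k, k < y -> exists v, rec_graph g [tuple of k :: xs] v.+1)
  end.

Definition total_recursive (f : nat -> nat) : Prop :=
  exists e : recfun 1, forall n m, f n = m <-> rec_graph e [tuple n] m.

Definition order_function (f : nat -> nat) : Prop :=
  [/\ {homo f : m n / m <= n}, total_recursive f & f @ \oo --> \oo].

Notation bitstring := (seq bool).

(* The length-lexicographic bijection from bitstring onto nat: the string s is
   sent to the number whose binary numeral is 1s, minus one. *)
Definition string_code (s : bitstring) : nat :=
  (foldl (fun v (b : bool) => v.*2 + b) 1 s).-1.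

Definition partial_recursive (F : bitstring -> option bitstring) : Prop :=
  exists e : recfun 1, forall p y,
    F p = Some y <-> rec_graph e [tuple string_code p] (string_code y).

Definition dom (F : bitstring -> option bitstring) : set bitstring :=
  [set p | F p <> None].

Definition prefix_free (A : set bitstring) : Prop :=
  forall p q, A p -> A q -> prefix p q -> p = q.

Definition prefix_free_machine (F : bitstring -> option bitstring) : Prop :=
  partial_recursive F /\ prefix_free (dom F).

Definition optimal (V : bitstring -> option bitstring) : Prop :=
  prefix_free_machine V /\
  forall F, prefix_free_machine F ->
    exists d : nat, forall p, dom F p ->
      exists q, [/\ dom V q, V q = F p & size q <= size p + d].

(* The sum is taken in the extended reals; by Kraft's inequality it is at most
   1 when [dom V] is prefix-free, so that [fine] loses nothing. *)
Definition Omega (R : realType) (V : bitstring -> option bitstring) : R :=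
  fine (\esum_(p in dom V) ((2^-1 : R) ^+ size p)%:E)%R.

(* [b i] is the bit of weight 2^-(i+1). *)
Definition base_two_expansion (R : realType) (alpha : R) (b : nat -> bool)
    : Prop :=
  (forall m, exists2 i, m <= i & b i = false) /\
  (series (fun i => (b i)%:R / 2 ^+ i.+1 : R) @ \oo -->
    (alpha - (Num.floor alpha)%:~R : R))%R.

Definition Pf (R : realType) (alpha : R) : set bitstring :=
  [set s | exists b n, base_two_expansion alpha b /\ s = mkseq b n].

Variant move := MoveLeft | MoveRight | Stay.

(* Tape symbols: the blank [None], the bits [Some (inl b)], and finitely many
   auxiliary symbols. *)
Definition symbol (aux : Type) : Type := option (bool + aux).

(* A two-way infinite tape [(l, r)]: [r] lists the cells from the scanned one
   rightwards and [l] those to its left, nearest first; the cells beyond the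
   end of either list are blank. *)
Definition tape (aux : Type) : Type := (seq (symbol aux) * seq (symbol aux))%type.

Definition tape_read aux (t : tape aux) : symbol aux := head None t.2.

Definition tape_write aux (a : symbol aux) (t : tape aux) : tape aux :=
  (t.1, a :: behead t.2).

Definition tape_move aux (d : move) (t : tape aux) : tape aux :=
  match d with
  | MoveLeft => (behead t.1, head None t.1 :: t.2)
  | MoveRight => (head None t.2 :: t.1, behead t.2)
  | Stay => t
  end.

(* The role of a control state of a machine with k tapes. *)
Variant role (Q aux : finType) (k : nat) :=
| Halt of bool
| Query of Q & Q
| Act of ({ffun 'I_k -> symbol aux} -> Q * {ffun 'I_k -> symbol aux * move}).

Arguments Halt {Q aux k}.
Arguments Query {Q aux k}.

(* Tape [ord0] initially holds the input and tape [ord_max] is the query tape;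
   there are [nwork] further work tapes. *)
Record oracleTM := OracleTM {
  state : finType;
  aux : finType;
  nwork : nat;
  start : state;
  state_role : state -> role state aux nwork.+2
}.

Definition config (M : oracleTM) : Type :=
  (state M * {ffun 'I_(nwork M).+2 -> tape (aux M)})%type.

Definition init_config (M : oracleTM) (x : bitstring) : config M :=
  (start M, [ffun i => ([::], if i == ord0 then [seq Some (inl b) | b <- x]
                              else [::])]).

Fixpoint leading_bits aux (s : seq (symbol aux)) : bitstring :=
  if s is Some (inl b) :: s' then b :: leading_bits s' else [::].

(* The string submitted to the oracle: the maximal block of bits that starts at
   the scanned cell of the query tape and extends to the right. *)
Definition query_string (M : oracleTM) (c : config M) : bitstring :=
  leading_bits (c.2 ord_max).2.

Definition step (M : oracleTM) (B : set bitstring) (c : config M) : config M :=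
  match state_role c.1 with
  | Halt _ => c
  | Query qyes qno => (if `[< B (query_string c) >] then qyes else qno, c.2)
  | Act delta =>
      let qa := delta [ffun i => tape_read (c.2 i)] in
      (qa.1,
       [ffun i => tape_move (qa.2 i).2 (tape_write (qa.2 i).1 (c.2 i))])
  end.

Definition config_at (M : oracleTM) (B : set bitstring) (x : bitstring)
  (t : nat) : config M := iter t (step B) (init_config M x).

Definition halts_with (M : oracleTM) (B : set bitstring) (x : bitstring)
  (answer : bool) : Prop :=
  exists t, state_role (config_at M B x t).1 = Halt answer.

Definition reduces_via (M : oracleTM) (A B : set bitstring) : Prop :=
  forall x, halts_with M B x `[< A x >].

Definition queries (M : oracleTM) (B : set bitstring) (x s : bitstring)
    : Prop :=
  exists t qyes qno,
    state_role (config_at M B x t).1 = Query qyes qno /\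
    s = query_string (config_at M B x t).

Definition reducible_in_query_size (f : nat -> nat) (A B : set bitstring)
    : Prop :=
  exists M : oracleTM,
    reduces_via M A B /\ forall x s, queries M B x s -> size s <= f (size x).

(* Main.v *)
Require Import Defs.
From mathcomp Require Import all_boot all_order all_algebra.
From mathcomp Require Import all_classical all_reals all_analysis.
From mathcomp Require Import finmap zify ring lra.

Set Implicit Arguments.
Unset Strict Implicit.
Unset Printing Implicit Defensive.
Import Order.TTheory GRing.Theory Num.Theory numFieldNormedType.Exports.

(** From the length bound to a reduction ([reduction_exists]).  Let [halting_stage]
    send each p in dom W to the string coding the stage at which the computation of
    W on p is seen to stop.  It is a prefix-free machine with the same domain as W,
    so the optimality of V gives a constant d such that every p in dom W has some q
    in dom V with V(q) coding that stage and |q| <= |p| + d.  Hence, to decide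
    whether x belongs to dom W, it is enough to know all the elements of dom V of
    length at most |x| + d.  These are determined by the first m = |x| + d + 1 bits of
    Omega_V: as soon as the weight of the programs that have halted by stage s is
    within 2^-m of the truncation of Omega_V to m bits, less than 2 * 2^-m of the
    weight is missing, so that no program of length less than m is
    ([stage_exists], [stage_complete]).  The slack 2^-m makes the search for s
    succeed even if Omega_V were a dyadic rational, and the integer part of Omega_V
    enters the program as a constant.  The bits themselves are obtained one at a time, by
    asking whether the known prefix followed by 1 lies in Pf(Omega_V); the longest
    query has length m.

    From a reduction to the length bound ([bounded_queries_absurd]).  Suppose M
    reduces dom W to Pf(Omega_V) with queries of length at most f(n) + c, while
    n - f(n) is unbounded.  Let n_k be the least n with f(n) + c + 2k + 1 <= n.  On
    the strings of length at most n_k, only the prefix s of Omega_V of length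
    f(n_k) + c matters to M.  The machine [diagonal] reads an input 0^k 1 s,
    replaces the oracle of M by the set of prefixes of s, runs M on all the strings
    of length at most n_k, runs W on those that M accepts, and returns a string
    different from all the values obtained.  Its domain is prefix-free because k
    determines the length of s.  Its input has length f(n_k) + c + k + 1 <= n_k - k;
    so if d is the constant that the optimality of W provides for this machine, the
    case k = d yields a program of W of length at most n_d for a value that no such
    program has.

    Both directions rest on two translations between models of computation.
    A recursive function is turned into an oracle machine by compiling it to
    programs over unary counters, one per tape ([compileP], [oracle_machine]).
    Conversely the run of a machine with a finite oracle is a computable function of
    the input, the oracle and the time ([c_simulate]), where computability of
    functions between encoded types reduces to total recursive functions on the
    natural numbers; partial recursive functions enter through their stage-bounded
    evaluation ([eval_uptoP], [c_eval_upto]). *)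

(** * Total recursive functions *)

(** Functions on sequences rather than on tuples: composing and projecting then involves
    no casts, and only the values on sequences of length n matter. *)
Definition rec_total n (f : seq nat -> nat) :=
  exists e : recfun n, forall (xs : n.-tuple nat) y,
    rec_graph e xs y <-> y = f xs.

Lemma rec_total_ext n f g : (forall xs, size xs = n -> f xs = g xs) ->
  rec_total n f -> rec_total n g.
Proof.
move=> fg [e eP]; exists e => xs y.
by rewrite -fg ?size_tuple.
Qed.

Lemma rec_total_zero n : rec_total n (fun _ => 0).
Proof. by exists (Zero n). Qed.

Lemma rec_total_succ : rec_total 1 (fun xs => (nth 0 xs 0).+1).
Proof.
by exists Succ => xs y /=; rewrite /thead (tnth_nth 0).
Qed.

Lemma rec_total_proj n i : i < n -> rec_total n (fun xs => nth 0 xs i).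
Proof.
move=> lin; exists (Proj (Ordinal lin)) => xs y /=.
by rewrite (tnth_nth 0).
Qed.

Lemma rec_total_comp n m g (h : nat -> seq nat -> nat) :
  rec_total m g -> (forall i, i < m -> rec_total n (h i)) ->
  rec_total n (fun xs => g [seq h i xs | i <- iota 0 m]).
Proof.
move=> [eg egP] hP.
have /choice [eh ehP] : forall i : 'I_m, exists e : recfun n,
    forall (xs : n.-tuple nat) y, rec_graph e xs y <-> y = h i xs.
  by move=> i; apply: hP.
exists (Comp eg eh) => xs y /=.
have sz : size [seq h i xs | i <- iota 0 m] == m by rewrite size_map size_iota.
have nthE i : i < m -> nth 0 [seq h i xs | i <- iota 0 m] i = h i xs.
  by move=> lim; rewrite (nth_map 0) ?size_iota // nth_iota.
split=> [[zs hzs /egP ->]|->].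
  congr (g _); apply: (@eq_from_nth _ 0).
    by rewrite size_tuple (eqP sz).
  move=> i; rewrite size_tuple => lim; rewrite nthE //.
  have /ehP := hzs (Ordinal lim).
  by rewrite (tnth_nth 0).
exists (Tuple sz); last exact/egP.
move=> i; apply/ehP; rewrite (tnth_nth 0) /= nthE //.
Qed.

Lemma rec_total_primrec n g h : rec_total n g -> rec_total n.+2 h ->
  rec_total n.+1 (fun xs => nat_rect (fun=> nat) (g (behead xs))
    (fun k u => h [:: k, u & behead xs]) (nth 0 xs 0)).
Proof.
move=> [eg egP] [eh ehP]; exists (PrimRec eg eh) => xs y /=.
rewrite /thead (tnth_nth 0) /=.
elim: (nth 0 xs 0) y => [|k IH] y /=; first exact: egP.
split=> [[u /IH -> /ehP //]|->].
by exists (nat_rect (fun=> nat) (g (behead xs))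
    (fun k u => h [:: k, u & behead xs]) k); [exact/IH|exact/ehP].
Qed.

Lemma rec_total_mu n g m : rec_total n.+1 g ->
  (forall xs, g (m xs :: xs) = 0) ->
  (forall xs k, k < m xs -> 0 < g (k :: xs)) -> rec_total n m.
Proof.
move=> [eg egP] m0 ltm; exists (Mu eg) => xs y /=.
split=> [[/egP /= gy ygt]|->].
  case: (ltngtP y (m xs)) => // [lt|/ygt [v /egP /=]].
    by have := ltm _ _ lt; rewrite -gy.
  by rewrite m0.
split; first by apply/egP; rewrite m0.
move=> k /ltm; case E: (g (k :: xs)) => [//|v] _.
by exists v; apply/egP; rewrite /= E.
Qed.

Definition rec1 (g : nat -> nat) := rec_total 1 (fun xs => g (nth 0 xs 0)).
Definition rec2 (g : nat -> nat -> nat) :=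
  rec_total 2 (fun xs => g (nth 0 xs 0) (nth 0 xs 1)).

Lemma rec_app1 n g h : rec1 g -> rec_total n h ->
  rec_total n (fun xs => g (h xs)).
Proof.
move=> rg rh; pose H i := nth (fun _ => 0) [:: h] i.
by apply: (@rec_total_comp n 1 (fun xs => g (nth 0 xs 0)) H) => // -[].
Qed.

Lemma rec_app2 n g h1 h2 : rec2 g -> rec_total n h1 -> rec_total n h2 ->
  rec_total n (fun xs => g (h1 xs) (h2 xs)).
Proof.
move=> rg r1 r2; pose H i := nth (fun _ => 0) [:: h1; h2] i.
by apply: (@rec_total_comp n 2 (fun xs => g (nth 0 xs 0) (nth 0 xs 1)) H) => // -[|[]].
Qed.

Lemma rec_total_cst n c : rec_total n (fun=> c).
Proof.
elim: c => [|c IH]; first exact: rec_total_zero.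
exact: (rec_app1 rec_total_succ IH).
Qed.

Lemma rec1_id : rec1 id. Proof. exact: rec_total_proj. Qed.

Lemma rec1_comp g h : rec1 g -> rec1 h -> rec1 (fun x => g (h x)).
Proof. exact: rec_app1. Qed.

Lemma rec1_comp2 g h1 h2 : rec2 g -> rec1 h1 -> rec1 h2 ->
  rec1 (fun x => g (h1 x) (h2 x)).
Proof. exact: rec_app2. Qed.

Lemma rec2_swap g : rec2 g -> rec2 (fun x y => g y x).
Proof.
by move=> rg; exact: (rec_app2 rg (@rec_total_proj 2 1 isT) (@rec_total_proj 2 0 isT)).
Qed.

Lemma rec2_primrec g h : rec1 g -> rec_total 3 h ->
  rec2 (fun n y => nat_rect (fun=> nat) (g y) (fun k u => h [:: k; u; y]) n).
Proof.
move=> rg rh; apply: rec_total_ext (rec_total_primrec rg rh).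
by case=> [|n [|y []]].
Qed.

Lemma rec2_add : rec2 addn.
Proof.
apply: rec_total_ext (rec2_primrec rec1_id
  (rec_app1 rec_total_succ (@rec_total_proj 3 1 isT))).
by case=> [|n [|y []]] //= _; elim: n => //= n ->.
Qed.

Lemma rec2_mul : rec2 muln.
Proof.
apply: rec_total_ext (rec2_primrec (rec_total_cst 1 0)
  (rec_app2 rec2_add (@rec_total_proj 3 1 isT) (@rec_total_proj 3 2 isT))).
by case=> [|n [|y []]] //= _; elim: n => //= n ->; rewrite mulSn addnC.
Qed.

Lemma rec1_pred : rec1 predn.
Proof.
have r : rec2 (fun n _ => n.-1).
  apply: rec_total_ext (rec2_primrec (rec_total_cst 1 0) (@rec_total_proj 3 0 isT)).
  by case=> [|n [|y []]] //= _; case: n.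
exact: (rec1_comp2 r rec1_id rec1_id).
Qed.

Lemma rec2_sub : rec2 subn.
Proof.
apply: rec2_swap.
apply: rec_total_ext (rec2_primrec rec1_id
  (rec_app1 rec1_pred (@rec_total_proj 3 1 isT))).
case=> [//|n [//|y [_|//]]].
have E m : nat_rect (fun=> nat) y (fun=> predn) m = y - m.
  by elim: m => [|m /= ->]; rewrite ?subn0 ?subnS.
exact: E.
Qed.

(** Both branches are total, so the case distinction is arithmetic: multiply by the
    indicators 1 - p and 1 - (1 - p). *)
Lemma rec_ifz n p f g : rec_total n p -> rec_total n f -> rec_total n g ->
  rec_total n (fun xs => if p xs == 0 then f xs else g xs).
Proof.
move=> rp rf rg.
have c1 := rec_total_cst n 1.
have rq := rec_app2 rec2_sub c1 rp.
have := rec_app2 rec2_add (rec_app2 rec2_mul rq rf)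
   (rec_app2 rec2_mul (rec_app2 rec2_sub c1 rq) rg).
apply: rec_total_ext => xs _; case: (p xs) => [|k] /=.
  by rewrite subn0 subnn mul1n mul0n addn0.
by rewrite subSS sub0n subn0 mul1n mul0n.
Qed.

(** The sum a + b can be read off as the integer square root of the pair, which makes the
    projections easy to define by a search. *)
Definition npair a b := (a + b) * (a + b) + a.

Lemma npair_bound a b :
  (a + b) * (a + b) <= npair a b < (a + b).+1 * (a + b).+1.
Proof. by rewrite leq_addr /npair /= mulSn mulnS; lia. Qed.

Lemma isqrt_exists z : exists s, z < s.+1 * s.+1.
Proof. by exists z; rewrite mulSn leq_addr. Qed.

Definition isqrt z := ex_minn (isqrt_exists z).

Lemma isqrt_npair a b : isqrt (npair a b) = a + b.
Proof.
rewrite /isqrt; case: ex_minnP => s zs smin.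
have /andP[lo hi] := npair_bound a b.
have := smin _ hi; rewrite leq_eqVlt => /orP[/eqP//|lt].
have : s.+1 * s.+1 <= (a + b) * (a + b) by exact: leq_mul.
by move=> /leq_trans /(_ lo); rewrite leqNgt zs.
Qed.

Definition nfst z := z - isqrt z * isqrt z.
Definition nsnd z := isqrt z - nfst z.

Lemma nfst_pair a b : nfst (npair a b) = a.
Proof. by rewrite /nfst isqrt_npair /npair addKn. Qed.

Lemma nsnd_pair a b : nsnd (npair a b) = b.
Proof. by rewrite /nsnd nfst_pair isqrt_npair addKn. Qed.

Lemma rec2_npair : rec2 npair.
Proof.
have a := @rec_total_proj 2 0 isT; have b := @rec_total_proj 2 1 isT.
have s := rec_app2 rec2_add a b.
exact: (rec_app2 rec2_add (rec_app2 rec2_mul s s) a).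
Qed.

Lemma rec1_isqrt : rec1 isqrt.
Proof.
have s1 := rec_app1 rec_total_succ (@rec_total_proj 2 0 isT).
have z1 := rec_app1 rec_total_succ (@rec_total_proj 2 1 isT).
have r := rec_app2 rec2_sub z1 (rec_app2 rec2_mul s1 s1).
apply: (rec_total_mu r) => [xs|xs k] /=; rewrite /isqrt; case: ex_minnP => s zs smin.
  by apply/eqP; rewrite subn_eq0.
rewrite subn_gt0 => lt; rewrite ltnS leqNgt; apply/negP => /smin.
by rewrite leqNgt lt.
Qed.

Lemma rec1_nfst : rec1 nfst.
Proof.
exact: (rec1_comp2 rec2_sub rec1_id (rec1_comp2 rec2_mul rec1_isqrt rec1_isqrt)).
Qed.

Lemma rec1_nsnd : rec1 nsnd.
Proof. exact: (rec1_comp2 rec2_sub rec1_isqrt rec1_nfst). Qed.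

Lemma rec1_pair g h : rec1 g -> rec1 h -> rec1 (fun x => npair (g x) (h x)).
Proof. exact: rec1_comp2 rec2_npair. Qed.

(** Primitive recursion with a parameter, in one variable: the parameter and the number
    of steps come paired, and the step function receives the triple paired to the right. *)
Lemma rec1_primrec g h : rec1 g -> rec1 h ->
  rec1 (fun z => nat_rect (fun=> nat) (g (nfst z))
    (fun k u => h (npair (nfst z) (npair k u))) (nsnd z)).
Proof.
move=> rg rh.
have r3 := rec_app1 rh (rec_app2 rec2_npair (@rec_total_proj 3 2 isT)
  (rec_app2 rec2_npair (@rec_total_proj 3 0 isT) (@rec_total_proj 3 1 isT))).
exact: (rec1_comp2 (rec2_primrec rg r3) rec1_nsnd rec1_nfst).
Qed.

Lemma rec1_ifz p f g : rec1 p -> rec1 f -> rec1 g ->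
  rec1 (fun x => if p x == 0 then f x else g x).
Proof. exact: rec_ifz. Qed.

(** The normal form through which every partial recursive function of this file is
    obtained: a single unbounded search over a total recursive test. *)
Lemma rec_search P g : rec1 P -> rec1 g -> exists e : recfun 1,
  forall z y, rec_graph e [tuple z] y <->
  exists t, [/\ P (npair z t) = 0, forall k, k < t -> P (npair z k) != 0
    & y = g (npair z t)].
Proof.
move=> rP rg.
have r2 h : rec1 h -> rec2 (fun x y => h (npair x y)).
  exact: (fun rh => rec_app1 rh rec2_npair).
have [eP ePP] := rec2_swap (r2 _ rP).
have [eg egP] := r2 _ rg.
(* The result is computed from the input and from the least witness. *)
exists (Comp eg (fun i => if i == ord0 then Proj ord0 else Mu eP)) => z y.
have muP t : rec_graph (Mu eP) [tuple z] t <->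
   P (npair z t) = 0 /\ forall k, k < t -> P (npair z k) != 0.
  split=> /= [[/ePP /= <- lt]|[P0 lt]]; split=> //.
  - by move=> k /lt [v /ePP /= <-].
  - exact/ePP.
  - move=> k /lt; case E: (P (npair z k)) => [//|v] _; exists v; exact/ePP.
split=> [[zs hzs /egP ->]|[t [P0 lt ->]]].
  exists (tnth zs (lift ord0 ord0)).
  have /= z0 := hzs ord0; rewrite (tnth_nth 0) /= in z0.
  have /muP [P0 lt] := hzs (lift ord0 ord0).
  by split => //=; rewrite z0 [tnth zs _](tnth_nth 0).
exists [tuple z; t]; last exact/egP.
move=> i; case: (unliftP ord0 i) => [j|] -> //.
by have -> : tnth [tuple z; t] (lift ord0 j) = t; [rewrite ord1|exact/muP].
Qed.

(** * Computable functions between encoded types *)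

(** Only injectivity is asked of an encoding, since a computable function is one that is
    tracked by a recursive function on the codes, whatever that function does elsewhere.
    Canonical structures find the encoding from the type. *)
Structure encType := EncType
  { enc_sort :> Type; encode : enc_sort -> nat; encode_inj : injective encode }.
Arguments encode {e} : rename.
Arguments encode_inj {e} [x1 x2] : rename.

(** The closure properties below carry the prefix [c_] and are stated pointwise in a
    common argument a, so that a proof of computability follows the syntax of the
    function. *)
Definition computable (A B : encType) (f : A -> B) :=
  exists2 g, rec1 g & forall a, g (encode a) = encode (f a).

Canonical nat_enc := EncType (@inj_id nat).

Lemma bool_code_inj : injective nat_of_bool. Proof. by case; case. Qed.
Canonical bool_enc := EncType bool_code_inj.

Section EncInstances.
Variables A B : encType.

Lemma pair_code_inj : injective (fun p : A * B => npair (encode p.1) (encode p.2)).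
Proof.
move=> [a b] [c d] /= E.
have := congr1 nfst E; have := congr1 nsnd E; rewrite !nfst_pair !nsnd_pair.
by move=> /encode_inj -> /encode_inj ->.
Qed.
Canonical pair_enc := EncType pair_code_inj.

Lemma option_code_inj :
  injective (fun o : option A => if o is Some a then (encode a).+1 else 0).
Proof. by move=> [a|] [b|] //= [] /encode_inj ->. Qed.
Canonical option_enc := EncType option_code_inj.

Lemma sum_code_inj : injective (fun s : A + B =>
  match s with inl a => npair 0 (encode a) | inr b => npair 1 (encode b) end).
Proof.
by move=> [a|a] [b|b] E; have := congr1 nfst E; have := congr1 nsnd E;
  rewrite !nsnd_pair !nfst_pair // => /encode_inj ->.
Qed.
Canonical sum_enc := EncType sum_code_inj.

Fixpoint seq_code (s : seq A) : nat :=
  if s is a :: s' then (npair (encode a) (seq_code s')).+1 else 0.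

Lemma seq_code_inj : injective seq_code.
Proof.
elim=> [|a s IH] [|b t] //= [] E.
have := congr1 nfst E; have := congr1 nsnd E; rewrite !nfst_pair !nsnd_pair.
by move=> /IH -> /encode_inj ->.
Qed.
Canonical seq_enc := EncType seq_code_inj.
End EncInstances.

Lemma enum_rank_code_inj (T : finType) : injective (fun x : T => enum_rank x : nat).
Proof. by move=> x y /val_inj /enum_rank_inj. Qed.
Definition fin_enc (T : finType) := EncType (@enum_rank_code_inj T).

Lemma c_ext (A B : encType) (f g : A -> B) : f =1 g -> computable f -> computable g.
Proof. by move=> fg [r rr rP]; exists r => // a; rewrite rP fg. Qed.

Lemma c_id (A : encType) : computable (fun a : A => a).
Proof. by exists id; first exact: rec1_id. Qed.

Lemma c_comp (A B C : encType) (f : B -> C) (h : A -> B) :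
  computable f -> computable h ->
  computable (fun a => f (h a)).
Proof.
move=> [r rr rP] [q rq qP]; exists (fun x => r (q x)); first exact: rec1_comp.
by move=> a; rewrite qP rP.
Qed.

Lemma c_cst (A B : encType) (b : B) : computable (fun _ : A => b).
Proof. by exists (fun=> encode b) => //; apply: rec_total_cst. Qed.

Lemma c_pair (A B C : encType) (f : A -> B) (g : A -> C) :
  computable f -> computable g ->
  computable (fun a => (f a, g a)).
Proof.
move=> [r rr rP] [q rq qP]; exists (fun x => npair (r x) (q x)).
  exact: rec1_pair.
by move=> a; rewrite rP qP.
Qed.

Lemma c_fst (A B C : encType) (f : A -> B * C) :
  computable f -> computable (fun a => (f a).1).
Proof.
move=> [r rr rP]; exists (fun x => nfst (r x)).
  exact: rec1_comp rec1_nfst rr.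
by move=> a; rewrite rP /= nfst_pair.
Qed.

Lemma c_snd (A B C : encType) (f : A -> B * C) :
  computable f -> computable (fun a => (f a).2).
Proof.
move=> [r rr rP]; exists (fun x => nsnd (r x)).
  exact: rec1_comp rec1_nsnd rr.
by move=> a; rewrite rP /= nsnd_pair.
Qed.

Lemma c_encode (A B : encType) (f : A -> B) :
  computable f -> computable (fun a => encode (f a)).
Proof. by move=> [r rr rP]; exists r. Qed.

Lemma c_nat1 (A : encType) r (f : A -> nat) : rec1 r -> computable f ->
  computable (fun a => r (f a)).
Proof.
move=> rr [q rq qP]; exists (fun x => r (q x)); first exact: rec1_comp.
by move=> a; rewrite qP.
Qed.

Lemma c_nat2 (A : encType) r (f g : A -> nat) : rec2 r -> computable f -> computable g ->
  computable (fun a => r (f a) (g a)).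
Proof.
move=> rr [q rq qP] [s rs sP]; exists (fun x => r (q x) (s x)).
  exact: rec1_comp2.
by move=> a; rewrite qP sP.
Qed.

Lemma c_Some (A B : encType) (f : A -> B) :
  computable f -> computable (fun a => Some (f a)).
Proof.
move=> [r rr rP]; exists (fun x => (r x).+1); last by move=> a; rewrite rP.
exact: (rec1_comp rec_total_succ).
Qed.

Lemma c_inl (A B C : encType) (f : A -> B) :
  computable f -> computable (fun a => inl (f a) : B + C).
Proof.
move=> [r rr rP]; exists (fun x => npair 0 (r x)); last by move=> a; rewrite rP.
exact: (rec1_pair (rec_total_cst 1 0) rr).
Qed.

Lemma c_cons (A B : encType) (f : A -> B) (g : A -> seq B) :
  computable f -> computable g ->
  computable (fun a => f a :: g a).
Proof.
move=> [r rr rP] [q rq qP]; exists (fun x => (npair (r x) (q x)).+1).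
  exact: (rec1_comp rec_total_succ (rec1_pair rr rq)).
by move=> a; rewrite rP qP.
Qed.

Lemma c_ocase (A B C : encType) (o : A -> option B) (f : A -> C) (g : A -> B -> C) :
  computable o -> computable f -> computable (fun p => g p.1 p.2) ->
  computable (fun a => if o a is Some b then g a b else f a).
Proof.
move=> [r rr rP] [q rq qP] [s rs sP].
exists (fun x => if r x == 0 then q x else s (npair x (r x).-1)).
  by apply: rec1_ifz => //; apply: (rec1_comp rs);
    apply: rec1_pair rec1_id (rec1_comp rec1_pred rr).
move=> a; rewrite rP; case: (o a) => [b|] /=; last exact: qP.
exact: sP (a, b).
Qed.

Lemma c_lcase (A B C : encType) (l : A -> seq B) (f : A -> C) (g : A -> B -> seq B -> C) :
  computable l -> computable f -> computable (fun p => g p.1 p.2.1 p.2.2) ->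
  computable (fun a => if l a is b :: s then g a b s else f a).
Proof.
move=> [r rr rP] [q rq qP] [s rs sP].
exists (fun x => if r x == 0 then q x else s (npair x (r x).-1)).
  by apply: rec1_ifz => //; apply: (rec1_comp rs);
    apply: rec1_pair rec1_id (rec1_comp rec1_pred rr).
move=> a; rewrite rP; case: (l a) => [|b t] /=; first exact: qP.
exact: sP (a, (b, t)).
Qed.

Lemma c_ncase (A C : encType) (n : A -> nat) (f : A -> C) (g : A -> nat -> C) :
  computable n -> computable f -> computable (fun p => g p.1 p.2) ->
  computable (fun a => if n a is k.+1 then g a k else f a).
Proof.
move=> [r rr rP] [q rq qP] [s rs sP].
exists (fun x => if r x == 0 then q x else s (npair x (r x).-1)).
  by apply: rec1_ifz => //; apply: (rec1_comp rs);
    apply: rec1_pair rec1_id (rec1_comp rec1_pred rr).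
move=> a; rewrite rP; case: (n a) => [|k] /=; first exact: qP.
exact: sP (a, k).
Qed.

Lemma c_scase (A B C D : encType) (o : A -> B + C) (f : A -> B -> D) (g : A -> C -> D) :
  computable o -> computable (fun p => f p.1 p.2) ->
  computable (fun p => g p.1 p.2) ->
  computable (fun a => match o a with inl b => f a b | inr c => g a c end).
Proof.
move=> [r rr rP] [q rq qP] [s rs sP].
have rarg : rec1 (fun x => npair x (nsnd (r x))).
  exact: rec1_pair rec1_id (rec1_comp rec1_nsnd rr).
exists (fun x => if nfst (r x) == 0 then q (npair x (nsnd (r x)))
                 else s (npair x (nsnd (r x)))).
  by apply: rec1_ifz; [exact: (rec1_comp rec1_nfst)
    |exact: (rec1_comp rq)|exact: (rec1_comp rs)].
move=> a; rewrite rP; case: (o a) => [b|c] /=; rewrite nfst_pair nsnd_pair /=.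
  exact: qP (a, b).
exact: sP (a, c).
Qed.

Lemma c_natrec (A B : encType) (n : A -> nat) (g : A -> B) (h : A -> nat -> B -> B) :
  computable n -> computable g -> computable (fun p => h p.1 p.2.1 p.2.2) ->
  computable (fun a => nat_rect (fun=> B) (g a) (h a) (n a)).
Proof.
move=> [r rr rP] [q rq qP] [s rs sP].
exists (fun x => (fun z => nat_rect (fun=> nat) (q (nfst z))
    (fun k u => s (npair (nfst z) (npair k u))) (nsnd z)) (npair x (r x))).
  apply: (rec1_comp (rec1_primrec rq rs)).
  exact: rec1_pair rec1_id rr.
move=> a /=; rewrite nfst_pair nsnd_pair rP /=.
elim: (n a) => [|k IH] /=; first exact: qP.
by rewrite IH; apply: sP (a, (k, _)).
Qed.

(** A function out of a finite type needs no uniformity: the recursive function is a table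
    with one entry per element.  In particular the transition table of a Turing machine may
    be an arbitrary function. *)
Lemma c_fincase (A B : encType) (T : finType) (cT : T -> nat) (cT_inj : injective cT)
  (k : A -> EncType cT_inj) (F : T -> A -> B) :
  computable k -> (forall t, computable (F t)) -> computable (fun a => F (k a) a).
Proof.
move=> [r rr rP] cF.
have [G rG GP] : exists2 G, rec1 G &
    forall a, k a \in enum T -> G (encode a) = encode (F (k a) a).
  elim: (enum T) => [|t s [G rG GP]].
    by exists (fun=> 0) => //; apply: rec_total_cst.
  have [g rg gP] := cF t.
  have rd : rec1 (fun x => (r x - cT t) + (cT t - r x)).
    have rc : rec1 (fun _ => cT t) by apply: rec_total_cst.
    apply: rec1_comp2 rec2_add _ _.
      exact: (rec1_comp2 rec2_sub rr rc).
    exact: (rec1_comp2 rec2_sub rc rr).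
  exists (fun x => if (r x - cT t) + (cT t - r x) == 0 then g x else G x).
    exact: rec1_ifz.
  move=> a; rewrite inE rP.
  have -> : (cT (k a) - cT t + (cT t - cT (k a)) == 0)
      = (k a == t).
    apply/idP/eqP => [|->]; last by rewrite subnn.
    rewrite addn_eq0 !subn_eq0 => E; apply/cT_inj/eqP.
    by rewrite eqn_leq.
  by case: eqP => [-> _|_ /= /GP].
by exists G => // a; apply: GP; rewrite mem_enum.
Qed.

Arguments c_id {A}.
Arguments c_cst {A B} b.

Lemma c_app2 (A B C D : encType) (f : B -> C -> D) (g : A -> B) (h : A -> C) :
  computable (fun p => f p.1 p.2) -> computable g -> computable h ->
  computable (fun a => f (g a) (h a)).
Proof. by move=> cf cg ch; apply: (c_comp cf (c_pair cg ch)). Qed.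

Lemma c_app3 (A B C D E : encType) (f : B -> C -> D -> E) (g : A -> B) (h : A -> C)
    (k : A -> D) :
  computable (fun p => f p.1 p.2.1 p.2.2) -> computable g -> computable h ->
  computable k -> computable (fun a => f (g a) (h a) (k a)).
Proof. by move=> cf cg ch ck; apply: (c_comp cf (c_pair cg (c_pair ch ck))). Qed.

Lemma c_if (A B : encType) (b : A -> bool) (f g : A -> B) :
  computable b -> computable f -> computable g ->
  computable (fun a => if b a then f a else g a).
Proof.
move=> cb cf cg.
apply: (c_fincase (F := fun t a => if t then f a else g a)) cb _.
by case.
Qed.

Lemma c_and (A : encType) (b c : A -> bool) : computable b -> computable c ->
  computable (fun a => b a && c a).
Proof. by move=> cb cc; exact: (c_if cb cc (c_cst false)). Qed.

Lemma c_or (A : encType) (b c : A -> bool) : computable b -> computable c ->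
  computable (fun a => b a || c a).
Proof. by move=> cb cc; exact: (c_if cb (c_cst true) cc). Qed.

Lemma c_neg (A : encType) (b : A -> bool) :
  computable b -> computable (fun a => ~~ b a).
Proof. by move=> cb; exact: (c_if cb (c_cst false) (c_cst true)). Qed.

Lemma c_S (A : encType) (f : A -> nat) : computable f -> computable (fun a => (f a).+1).
Proof. exact: (c_nat1 rec_total_succ). Qed.

Lemma c_add (A : encType) (f g : A -> nat) : computable f -> computable g ->
  computable (fun a => f a + g a).
Proof. exact: (c_nat2 rec2_add). Qed.

Lemma c_sub (A : encType) (f g : A -> nat) : computable f -> computable g ->
  computable (fun a => f a - g a).
Proof. exact: (c_nat2 rec2_sub). Qed.

Lemma c_mul (A : encType) (f g : A -> nat) : computable f -> computable g ->
  computable (fun a => f a * g a).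
Proof. exact: (c_nat2 rec2_mul). Qed.

Lemma c_pred (A : encType) (f : A -> nat) :
  computable f -> computable (fun a => (f a).-1).
Proof. exact: (c_nat1 rec1_pred). Qed.

Lemma c_eq0 (A : encType) (f : A -> nat) :
  computable f -> computable (fun a => f a == 0).
Proof.
move=> cf; apply: (@c_ext _ _ (fun a => if f a is k.+1 then false else true)).
  by move=> a; case: (f a).
by apply: c_ncase => //; apply: c_cst.
Qed.

Lemma c_leq (A : encType) (f g : A -> nat) : computable f -> computable g ->
  computable (fun a => f a <= g a).
Proof. by move=> cf cg; apply: c_eq0; apply: c_sub. Qed.

Lemma c_eqn (A : encType) (f g : A -> nat) : computable f -> computable g ->
  computable (fun a => f a == g a).
Proof.
move=> cf cg; apply: (@c_ext _ _ (fun a => (f a <= g a) && (g a <= f a))).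
  by move=> a; rewrite eqn_leq.
by apply: c_and; apply: c_leq.
Qed.

Lemma c_iter (A B : encType) (n : A -> nat) (g : A -> B) (h : A -> B -> B) :
  computable n -> computable g -> computable (fun p => h p.1 p.2) ->
  computable (fun a => iter (n a) (h a) (g a)).
Proof.
move=> cn cg ch.
apply: (@c_ext _ _ (fun a => nat_rect (fun=> B) (g a) (fun _ => h a) (n a))).
  by move=> a; elim: (n a) => //= k ->.
apply: c_natrec => //.
by apply: (c_app2 ch); [exact: (c_fst c_id)|exact: (c_snd (c_snd c_id))].
Qed.

Lemma c_exp2 (A : encType) (f : A -> nat) :
  computable f -> computable (fun a => 2 ^ f a).
Proof.
move=> cf; apply: (@c_ext _ _ (fun a => iter (f a) (muln 2) 1)).
  by move=> a; rewrite iter_muln muln1.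
apply: (c_iter (g := fun=> 1) (h := fun=> muln 2) cf (c_cst 1)).
exact: (c_mul (c_cst 2) (c_snd c_id)).
Qed.

Lemma size_leq_code (B : encType) (s : seq B) : size s <= encode s.
Proof.
elim: s => //= b s IH; rewrite ltnS; apply: leq_trans IH _.
have /andP[+ _] := npair_bound (encode b) (seq_code s).
by apply: leq_trans; rewrite mulnDr !mulnDl; nia.
Qed.

Lemma c_behead (A B : encType) (l : A -> seq B) :
  computable l -> computable (fun a => behead (l a)).
Proof.
move=> cl; apply: (@c_ext _ _ (fun a => if l a is b :: s then s else [::])).
  by move=> a; case: (l a).
by apply: c_lcase => //; [exact: c_cst|exact: (c_snd (c_snd c_id))].
Qed.

Lemma c_head (A B : encType) (b : B) (l : A -> seq B) : computable l ->
  computable (fun a => head b (l a)).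
Proof.
move=> cl; apply: (@c_ext _ _ (fun a => if l a is b :: s then b else b)).
  by move=> a; case: (l a).
by apply: c_lcase => //; [exact: c_cst|exact: (c_fst (c_snd c_id))].
Qed.

(** The loop runs for as many steps as the code of the list, a computable bound on its
    length. *)
Lemma c_foldl (A B C : encType) (l : A -> seq B) (z : A -> C) (h : A -> C -> B -> C) :
  computable l -> computable z -> computable (fun p => h p.1 p.2.1 p.2.2) ->
  computable (fun a => foldl (h a) (z a) (l a)).
Proof.
move=> cl cz ch.
pose st a (q : C * seq B) := if q.2 is b :: s then (h a q.1 b, s) else q.
apply: (@c_ext _ _ (fun a => (iter (encode (l a)) (st a) (z a, l a)).1)).
  move=> a; have := size_leq_code (l a).
  move: (encode (l a)) => m.
  elim: m (z a) (l a) => [|n IH] c [|b s] //.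
    move=> _; rewrite iterSr /st /=; exact: IH.
  by rewrite ltnS iterSr => /(IH (h a c b)) /= <-.
apply: c_fst; apply: c_iter; first exact: c_encode.
  exact: c_pair.
rewrite /st; apply: (c_lcase (l := fun p : A * (C * seq B) => p.2.2)
  (f := fun p => p.2) (g := fun p b s => (h p.1 p.2.1 b, s))).
- exact: (c_snd (c_snd c_id)).
- exact: (c_snd c_id).
apply: c_pair; last exact: (c_snd (c_snd c_id)).
apply: (c_app3 ch); [exact: (c_fst (c_fst c_id))
  |exact: (c_fst (c_snd (c_fst c_id)))|exact: (c_fst (c_snd c_id))].
Qed.

Lemma c_rev (A B : encType) (l : A -> seq B) :
  computable l -> computable (fun a => rev (l a)).
Proof.
move=> cl; apply: (@c_ext _ _ (fun a => foldl (fun s b => b :: s) [::] (l a))).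
  by move=> a; rewrite /rev; elim: (l a) [::] => //= b s IH t; apply: IH.
apply: (c_foldl (z := fun=> [::]) (h := fun _ s b => b :: s) cl (c_cst [::])).
exact: (c_cons (c_snd (c_snd c_id)) (c_fst (c_snd c_id))).
Qed.

Lemma c_foldr (A B C : encType) (l : A -> seq B) (z : A -> C) (h : A -> B -> C -> C) :
  computable l -> computable z -> computable (fun p => h p.1 p.2.1 p.2.2) ->
  computable (fun a => foldr (h a) (z a) (l a)).
Proof.
move=> cl cz ch.
apply: (@c_ext _ _ (fun a => foldl (fun c b => h a b c) (z a) (rev (l a)))).
  by move=> a; rewrite foldl_rev.
apply: (c_foldl (h := fun a c b => h a b c)) (c_rev cl) cz _.
exact: (c_app3 ch (c_fst c_id) (c_snd (c_snd c_id)) (c_fst (c_snd c_id))).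
Qed.

Lemma c_map (A B C : encType) (l : A -> seq B) (f : A -> B -> C) : computable l ->
  computable (fun p => f p.1 p.2) -> computable (fun a => [seq f a b | b <- l a]).
Proof.
move=> cl cf.
apply: (c_foldr (h := fun a b s => f a b :: s) cl (c_cst [::])).
apply: c_cons; last exact: (c_snd (c_snd c_id)).
exact: (c_app2 cf (c_fst c_id) (c_fst (c_snd c_id))).
Qed.

Lemma c_cat (A B : encType) (l m : A -> seq B) : computable l -> computable m ->
  computable (fun a => l a ++ m a).
Proof.
move=> cl cm.
apply: (@c_ext _ _ (fun a => foldr cons (m a) (l a))).
  by move=> a; elim: (l a) => //= b s ->.
apply: (c_foldr (h := fun _ => cons) cl cm).
exact: (c_cons (c_fst (c_snd c_id)) (c_snd (c_snd c_id))).
Qed.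

Lemma c_rcons (A B : encType) (l : A -> seq B) (f : A -> B) :
  computable l -> computable f ->
  computable (fun a => rcons (l a) (f a)).
Proof.
move=> cl cf; apply: (@c_ext _ _ (fun a => l a ++ [:: f a])).
  by move=> a; rewrite cats1.
exact: (c_cat cl (c_cons cf (c_cst [::]))).
Qed.

Lemma c_size (A B : encType) (l : A -> seq B) :
  computable l -> computable (fun a => size (l a)).
Proof.
move=> cl.
apply: (c_foldr (h := fun _ _ n => n.+1) cl (c_cst 0)).
exact: (c_S (c_snd (c_snd c_id))).
Qed.

Lemma c_drop (A B : encType) (n : A -> nat) (l : A -> seq B) :
  computable n -> computable l ->
  computable (fun a => drop (n a) (l a)).
Proof.
move=> cn cl; apply: (@c_ext _ _ (fun a => iter (n a) behead (l a))).
  by move=> a; elim: (n a) => [|k /= ->]; rewrite ?drop0 // -drop1 drop_drop.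
apply: (c_iter (h := fun=> behead) cn cl).
exact: (c_behead (c_snd c_id)).
Qed.

Lemma c_nth (A B : encType) (b : B) (n : A -> nat) (l : A -> seq B) : computable n ->
  computable l -> computable (fun a => nth b (l a) (n a)).
Proof.
move=> cn cl; apply: (@c_ext _ _ (fun a => head b (drop (n a) (l a)))).
  by move=> a; rewrite -nth0 nth_drop addn0.
exact: (c_head b (c_drop cn cl)).
Qed.

Lemma c_iota (A : encType) (n : A -> nat) :
  computable n -> computable (fun a => iota 0 (n a)).
Proof.
move=> cn.
apply: (@c_ext _ _ (fun a => nat_rect _ [::] (fun k s => rcons s k) (n a))).
  move=> a; elim: (n a) => // k IH; rewrite [LHS]/= IH -[in RHS]addn1.
  by rewrite iotaD cats1.
apply: (c_natrec (h := fun _ k s => rcons s k) cn (c_cst [::])).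
exact: (c_rcons (c_snd (c_snd c_id)) (c_fst (c_snd c_id))).
Qed.

Lemma c_has (A B : encType) (l : A -> seq B) (P : A -> B -> bool) : computable l ->
  computable (fun p => P p.1 p.2) -> computable (fun a => has (P a) (l a)).
Proof.
move=> cl cP.
apply: (@c_ext _ _ (fun a => foldr (fun b c => P a b || c) false (l a))).
  by move=> a; elim: (l a) => //= b s ->.
apply: (c_foldr (h := fun a b c => P a b || c) cl (c_cst false)).
apply: c_or; last exact: (c_snd (c_snd c_id)).
exact: (c_app2 cP (c_fst c_id) (c_fst (c_snd c_id))).
Qed.

Lemma c_all (A B : encType) (l : A -> seq B) (P : A -> B -> bool) : computable l ->
  computable (fun p => P p.1 p.2) -> computable (fun a => all (P a) (l a)).
Proof.
move=> cl cP.
apply: (@c_ext _ _ (fun a => foldr (fun b c => P a b && c) true (l a))).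
  by move=> a; elim: (l a) => //= b s ->.
apply: (c_foldr (h := fun a b c => P a b && c) cl (c_cst true)).
apply: c_and; last exact: (c_snd (c_snd c_id)).
exact: (c_app2 cP (c_fst c_id) (c_fst (c_snd c_id))).
Qed.

Lemma c_find (A B : encType) (l : A -> seq B) (P : A -> B -> bool) : computable l ->
  computable (fun p => P p.1 p.2) -> computable (fun a => find (P a) (l a)).
Proof.
move=> cl cP.
apply: (@c_ext _ _ (fun a => foldr (fun b n => if P a b then 0 else n.+1) 0 (l a))).
  by move=> a; elim: (l a) => //= b s ->.
apply: (c_foldr (h := fun a b n => if P a b then 0 else n.+1) cl (c_cst 0)).
apply: c_if; last exact: (c_S (c_snd (c_snd c_id))).
  exact: (c_app2 cP (c_fst c_id) (c_fst (c_snd c_id))).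
exact: c_cst.
Qed.

Lemma c_sumn (A : encType) (l : A -> seq nat) :
  computable l -> computable (fun a => sumn (l a)).
Proof.
move=> cl.
apply: (c_foldr (h := fun _ => addn) cl (c_cst 0)).
exact: (c_add (c_fst (c_snd c_id)) (c_snd (c_snd c_id))).
Qed.

Lemma c_odd (A : encType) (f : A -> nat) :
  computable f -> computable (fun a => odd (f a)).
Proof.
move=> cf; apply: (@c_ext _ _ (fun a => iter (f a) negb false)).
  by move=> a; elim: (f a) => //= n ->.
exact: (c_iter (h := fun=> negb) cf (c_cst false) (c_neg (c_snd c_id))).
Qed.

Lemma c_double (A : encType) (f : A -> nat) :
  computable f -> computable (fun a => (f a).*2).
Proof.
move=> cf; apply: (@c_ext _ _ (fun a => f a + f a)); last exact: c_add.
by move=> a; rewrite addnn.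
Qed.

Lemma c_half (A : encType) (f : A -> nat) :
  computable f -> computable (fun a => (f a)./2).
Proof.
move=> cf.
pose h k n := if odd k then n.+1 else n.
apply: (@c_ext _ _ (fun a => nat_rect _ 0 h (f a))).
  move=> a; elim: (f a) => //= n ->; rewrite uphalfE /h -addn1 -[n.+1]addn1 halfD.
  by case: (odd n); rewrite /= ?addn0 ?addn1.
apply: (c_natrec (h := fun=> h) cf (c_cst 0)).
exact: (c_if (c_odd (c_fst (c_snd c_id))) (c_S (c_snd (c_snd c_id)))
  (c_snd (c_snd c_id))).
Qed.

(** * Binary strings and unbounded search *)

(** Binary digits of n.+1, most significant first and without the leading 1. *)
Definition string_decode n : seq bool :=
  (iter n (fun q : nat * seq bool =>
     if q.1 <= 1 then q else (q.1./2, odd q.1 :: q.2)) (n.+1, [::])).2.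

Definition numeral s := foldl (fun v (b : bool) => v.*2 + b) 1 s.

Lemma numeral_rcons s b : numeral (rcons s b) = (numeral s).*2 + b.
Proof. by rewrite /numeral foldl_rcons. Qed.

Lemma numeral_ge s : 2 ^ size s <= numeral s.
Proof.
elim/last_ind: s => // s b IH; rewrite numeral_rcons size_rcons expnS mul2n.
by apply: leq_trans (leq_addr _ _); rewrite leq_double.
Qed.

Lemma numeral_lt s : numeral s < 2 ^ (size s).+1.
Proof.
elim/last_ind: s => // s b IH; rewrite numeral_rcons size_rcons expnS.
by case: b; lia.
Qed.

Lemma numeral_gt0 s : 0 < numeral s.
Proof. by apply: leq_trans (numeral_ge s); rewrite expn_gt0. Qed.

Lemma string_codeE s : (string_code s).+1 = numeral s.
Proof. by rewrite /string_code prednK // numeral_gt0. Qed.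

Lemma string_code_inj : injective string_code.
Proof.
move=> s t /(congr1 S); rewrite !string_codeE.
elim/last_ind: s t => [|s b IH] t; elim/last_ind: t => [|t c _] //.
- by rewrite numeral_rcons; have := numeral_gt0 t; case: c => /=; rewrite /numeral /=; lia.
- by rewrite numeral_rcons; have := numeral_gt0 s; case: b => /=; rewrite /numeral /=; lia.
rewrite !numeral_rcons => E.
have bc : b = c by have := congr1 odd E; rewrite !oddD !odd_double /=; case: (b); case: (c).
by move: E; rewrite bc => /addIn /double_inj /IH ->.
Qed.

Lemma string_decodeK : cancel string_decode string_code.
Proof.
move=> n; apply: succn_inj; rewrite string_codeE /string_decode.
set f := (fun q : nat * seq bool => _).
have inv m q : 0 < q.1 -> q.1 <= m.+1 ->
    foldl (fun v (b : bool) => v.*2 + b) q.1 q.2 = numeral (iter m f q).2.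
  elim: m q => [|m IH] q q0 qm.
    by rewrite /= /numeral; congr foldl; lia.
  rewrite iterSr -IH /f.
  - by case: ifP => //= _; rewrite addnC odd_double_half.
  - by case: ifP => //= q1; rewrite half_gt0 ltnNge q1.
  - by case: ifP => /= q1; lia.
by rewrite -inv.
Qed.

Lemma string_codeK : cancel string_code string_decode.
Proof. by move=> s; apply: string_code_inj; rewrite string_decodeK. Qed.

Lemma string_code_lt s n : string_code s < n -> size s < n.
Proof.
apply: leq_ltn_trans; rewrite -ltnS string_codeE.
exact: leq_trans (ltn_expl _ _) (numeral_ge s).
Qed.

Lemma string_code_size s n : (string_code s < (2 ^ n.+1).-1) = (size s <= n).
Proof.
have e0 : 0 < 2 ^ n.+1 by rewrite expn_gt0.
rewrite -ltnS prednK // string_codeE; apply/idP/idP => h.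
  by rewrite -ltnS -(ltn_exp2l (m := 2)) //; apply: leq_ltn_trans (numeral_ge s) h.
by apply: leq_trans (numeral_lt s) _; rewrite leq_exp2l.
Qed.

Lemma c_string_code (A : encType) (s : A -> seq bool) : computable s ->
  computable (fun a => string_code (s a)).
Proof.
move=> cs; apply: c_pred.
apply: (c_foldl (h := fun _ v (b : bool) => v.*2 + b) cs (c_cst 1)).
apply: c_add; first exact: (c_double (c_fst (c_snd c_id))).
have [r rr rP] := @c_snd (pair_enc A (pair_enc nat_enc bool_enc)) _ _ _ (c_snd c_id).
by exists r.
Qed.

Lemma c_string_decode (A : encType) (n : A -> nat) : computable n ->
  computable (fun a => string_decode (n a)).
Proof.
move=> cn; apply: c_snd.
apply: (c_iter (h := fun _ (q : nat * seq bool) =>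
     if q.1 <= 1 then q else (q.1./2, odd q.1 :: q.2)) cn
     (c_pair (c_S cn) (c_cst [::]))).
have q1 := c_fst (c_snd (@c_id (pair_enc A (pair_enc nat_enc (seq_enc bool_enc))))).
apply: (c_if (c_leq q1 (c_cst 1)) (c_snd c_id)).
exact: (c_pair (c_half q1) (c_cons (c_odd q1) (c_snd (c_snd c_id)))).
Qed.
Lemma search_recursive (P : nat -> nat -> bool) (g : nat -> nat -> nat) :
  computable (fun p : nat * nat => P p.1 p.2) ->
  computable (fun p : nat * nat => g p.1 p.2) ->
  exists e : recfun 1, forall z y, rec_graph e [tuple z] y <->
    exists t, [/\ P z t, forall k, k < t -> ~~ P z k & y = g z t].
Proof.
move=> /c_neg [r rr rP] [q rq qP].
have [e eP] := rec_search rr rq; exists e => z y.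
rewrite eP; split=> -[t [Pt lt ->]]; exists t.
  split.
  - by move: Pt (rP (z, t)) => /= -> /=; case: (P z t).
  - by move=> k /lt; rewrite (rP (z, k)) /=; case: (P z k).
  - exact: qP (z, t).
split.
- by rewrite (rP (z, t)) /= Pt.
- by move=> k /lt; rewrite (rP (z, k)) /=; case: (P z k).
- by rewrite (qP (z, t)).
Qed.

(** Both auxiliary machines of the proof have this shape: wait for the first stage that
    passes a decidable test and compute the output from it. *)
Definition search_machine (P : seq bool -> nat -> bool)
    (g : seq bool -> nat -> seq bool) (p : seq bool) : option (seq bool) :=
  if pselect (exists t, P p t) is left h then Some (g p (ex_minn h)) else None.

Lemma search_machineP P g p y : search_machine P g p = Some y <->
  exists t, [/\ P p t, forall k, k < t -> ~~ P p k & y = g p t].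
Proof.
rewrite /search_machine; case: pselect => h; split=> //.
- move=> [<-]; case: ex_minnP => s hs smin; exists s; split=> // k ks.
  by apply/negP => /smin; rewrite leqNgt ks.
- move=> [t [ht lt ->]]; case: ex_minnP => s hs smin; congr (Some (g _ _)).
  apply/eqP; rewrite eqn_leq smin //= leqNgt; apply/negP => /lt.
  by rewrite hs.
- by move=> [t [ht _ _]]; case: h; exists t.
Qed.

Lemma dom_search_machine P g p : dom (search_machine P g) p <-> exists t, P p t.
Proof. by rewrite /dom /= /search_machine; case: pselect => h; split. Qed.

Lemma search_machine_recursive P g :
  computable (fun p : seq bool * nat => P p.1 p.2) ->
  computable (fun p : seq bool * nat => g p.1 p.2) ->
  partial_recursive (search_machine P g).
Proof.
move=> cP cg.
have cd : computable (fun p : nat * nat => string_decode p.1).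
  exact: (c_string_decode (c_fst c_id)).
have [e eP] := search_recursive
  (P := fun n => P (string_decode n))
  (g := fun n t => string_code (g (string_decode n) t))
  (c_app2 cP cd (c_snd c_id)) (c_string_code (c_app2 cg cd (c_snd c_id))).
exists e => p y; rewrite search_machineP eP string_codeK.
split=> -[t [Pt lt E]]; exists t; split => //; first by rewrite E.
exact: string_code_inj.
Qed.

(** * Stage-bounded evaluation of recursive functions *)

Definition all_some A (s : seq (option A)) : option (seq A) :=
  foldr (fun o r => if o is Some a then omap (cons a) r else None) (Some [::]) s.

Lemma all_some_map A B (f : A -> option B) (g : A -> B) s :
  (forall a, f a = Some (g a)) -> all_some [seq f a | a <- s] = Some [seq g a | a <- s].
Proof. by move=> fg; elim: s => //= a s ->; rewrite fg. Qed.

Lemma all_some_mapE A B (f : A -> option B) s t : all_some [seq f a | a <- s] = Some t ->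
  [seq f a | a <- s] = [seq Some b | b <- t].
Proof.
elim: s t => [|a s IH] t /=; first by case=> <-.
case: (f a) => //= b; case E: (all_some _) => [r|] //= [<-] /=.
by rewrite (IH _ E).
Qed.

(** The value of the function denoted by e if it is found by stage s: unbounded searches
    are cut at s.  Unlike [rec_graph] this is a total function, hence computable
    ([c_eval_upto]), and [rec_graph] is its increasing union ([eval_upto_mono],
    [eval_uptoP]). *)
Fixpoint eval_upto n (e : recfun n) (s : nat) (xs : seq nat) : option nat :=
  match e with
  | Zero _ => Some 0
  | Succ => Some (nth 0 xs 0).+1
  | Proj _ i => Some (nth 0 xs i)
  | Comp m _ g h => obind (eval_upto g s)
      (all_some [seq eval_upto (h i) s xs | i <- enum 'I_m])
  | PrimRec _ g h => nat_rect (fun=> option nat) (eval_upto g s (behead xs))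
      (fun k r => obind (fun u => eval_upto h s [:: k, u & behead xs]) r) (nth 0 xs 0)
  | Mu _ g =>
      let y := find (fun k => if eval_upto g s (k :: xs) is Some _.+1 then false else true)
        (iota 0 s) in
      if eval_upto g s (y :: xs) is Some 0 then Some y else None
  end.

Lemma find_iotaP (P : pred nat) s y : y < s -> P y -> (forall k, k < y -> ~~ P k) ->
  find P (iota 0 s) = y.
Proof.
move=> ys Py lty.
have hP : has P (iota 0 s) by apply/hasP; exists y; rewrite ?mem_iota.
have fs : find P (iota 0 s) < s by rewrite -{2}(size_iota 0 s) -has_find.
have nf := nth_find 0 hP; rewrite nth_iota // add0n in nf.
case: (ltngtP (find P (iota 0 s)) y) => // [/lty|yf]; first by rewrite nf.
have := before_find 0 yf; rewrite nth_iota // add0n.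
by rewrite Py.
Qed.

Lemma find_iota_before (P : pred nat) s k : k < find P (iota 0 s) -> ~~ P k.
Proof.
move=> kf; have := before_find 0 kf; rewrite nth_iota ?add0n => [->//|].
by apply: leq_trans kf _; rewrite -{2}(size_iota 0 s) find_size.
Qed.

(** For a search, a witness found below s, or at s itself when the values below s are
    all positive, is still the first one below a larger bound. *)
Lemma eval_upto_mono n (e : recfun n) s s' xs y : s <= s' ->
  eval_upto e s xs = Some y -> eval_upto e s' xs = Some y.
Proof.
rewrite leq_eqVlt => /orP[/eqP<-//|ss'].
elim: e xs y => //= {n} [m n g IHg h IHh|n g IHg h IHh|n g IHg] xs y.
- case E: (all_some _) => [zs|] //= gzs.
  have -> : all_some [seq eval_upto (h i) s' xs | i <- enum 'I_m] = Some zs.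
    elim: (enum 'I_m) zs E {gzs} => //= i l IH zs.
    case E: (eval_upto _ s xs) => [a|] //; rewrite (IHh _ _ _ E).
    by case: (all_some _) IH => [r|] //= /(_ r erefl) ->.
  exact: IHg.
- elim: (nth 0 xs 0) y => [|k IH] y /=; first exact: IHg.
  case: (nat_rect _ _ _ _) IH => [u|] // /(_ u erefl) -> /=; exact: IHh.
set y0 := find _ (iota 0 s); case E: (eval_upto g s _) => [[|]|] // [<-].
rewrite (@find_iotaP _ _ y0) ?(IHg _ _ E) //.
  by apply: leq_ltn_trans ss'; rewrite -[leqRHS](size_iota 0 s) find_size.
move=> k /find_iota_before; case E': (eval_upto g s _) => [[|v]|] // _.
by rewrite (IHg _ _ E').
Qed.

(** Finitely many events that each happen at some stage, and then persist, have all
    happened at a common stage. *)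
Lemma uniform_stage (I : finType) (Q : I -> nat -> Prop) :
  (forall i s s', s <= s' -> Q i s -> Q i s') ->
  (forall i, exists s, Q i s) -> exists s, forall i, Q i s.
Proof.
move=> mono /choice [s sP]; exists (\max_i s i) => i.
by apply: mono (sP i); apply: leq_bigmax.
Qed.

Lemma eval_uptoP n (e : recfun n) (xs : n.-tuple nat) y :
  rec_graph e xs y <-> exists s, eval_upto e s xs = Some y.
Proof.
elim: e xs y => {n} [n||n i|m n g IHg h IHh|n g IHg h IHh|n g IHg] xs y /=.
- by split=> [->|[_ [<-]]] //; exists 0.
- by rewrite /thead (tnth_nth 0); split=> [->|[_ [<-]]] //; exists 0.
- by rewrite (tnth_nth 0); split=> [->|[_ [<-]]] //; exists 0.
- split=> [[zs hzs /IHg [s gs]]|[s]].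
    have [|t tP] := @uniform_stage _ (fun i t => eval_upto (h i) t xs = Some (tnth zs i)) _
      (fun i => (IHh i _ _).1 (hzs i)).
      by move=> i t t'; apply: eval_upto_mono.
    exists (maxn s t).
    have -> : all_some [seq eval_upto (h i) (maxn s t) xs | i <- enum 'I_m] = Some (val zs).
      rewrite (@all_some_map _ _ _ (tnth zs)); last first.
        by move=> i; apply: eval_upto_mono (tP i); apply: leq_maxr.
      by congr Some; rewrite -(val_ord_tuple m) -[RHS](map_tnth_enum zs).
    by apply: eval_upto_mono gs; apply: leq_maxl.
  case E: (all_some _) => [zs|] //= gzs; have := all_some_mapE E => {}E.
  have sz : size zs == m.
    by rewrite -(size_map Some) -E size_map size_enum_ord.
  exists (Tuple sz); last by apply/IHg; exists s.
  move=> i; apply/IHh; exists s; rewrite (tnth_nth 0) /=.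
  have := congr1 (fun l => nth None l i) E.
  rewrite (nth_map i) ?size_enum_ord // nth_ord_enum => ->.
  by rewrite (nth_map 0) // (eqP sz).
- rewrite /thead (tnth_nth 0).
  have IHg' y' : rec_graph g [tuple of behead xs] y' <->
    exists s, eval_upto g s (behead xs) = Some y' by exact: IHg.
  have IHh' k u y' : rec_graph h [tuple of k :: u :: [tuple of behead xs]] y' <->
    exists s, eval_upto h s [:: k, u & behead xs] = Some y' by exact: IHh.
  elim: (nth 0 xs 0) y => [|k IH] y /=; first exact: IHg'.
  split=> [[u /IH [s us] /IHh' [t ht]]|[s]].
    exists (maxn s t).
    set r := nat_rect _ _ _ _.
    have -> : r = Some u.
      have M := @eval_upto_mono _ (PrimRec g h) s (maxn s t) (k :: behead xs) u
        (leq_maxl _ _) us.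
      exact: M.
    by rewrite /=; apply: eval_upto_mono ht; apply: leq_maxr.
  case E: (nat_rect _ _ _ _) => [u|] //= hu.
  by exists u; [apply/IH; exists s|apply/IHh'; exists s].
have IHg' k y' : rec_graph g [tuple of k :: xs] y' <->
    exists s, eval_upto g s (k :: xs) = Some y' by exact: IHg.
split=> [[/IHg' [s gs] lt]|[s]].
  have {}lt : forall k : 'I_y, exists t, exists v,
      eval_upto g t ((k : nat) :: xs) = Some v.+1.
    by move=> k; have [v /IHg' [t tP]] := lt k (ltn_ord k); exists t, v.
  have [|t tP] := uniform_stage _ lt.
    by move=> i t t' tt' [v vP]; exists v; apply: eval_upto_mono vP.
  exists (maxn (maxn s t) y.+1).
  have gs' := eval_upto_mono (leq_trans (leq_maxl s t) (leq_maxl _ y.+1)) gs.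
  rewrite (@find_iotaP _ _ y) ?gs' ?leq_maxr // => k ky.
  have [v vP] := tP (Ordinal ky).
  by rewrite (eval_upto_mono (leq_trans (leq_maxr s t) (leq_maxl _ y.+1)) vP).
set y0 := find _ (iota 0 s); case E: (eval_upto g s _) => [[|]|] // [<-].
split; first by apply/IHg'; exists s.
move=> k /find_iota_before; case E': (eval_upto g s _) => [[|v]|] // _.
by exists v; apply/IHg'; exists s.
Qed.

Lemma c_all_some (A B : encType) (l : A -> seq (option B)) : computable l ->
  computable (fun a => all_some (l a)).
Proof.
move=> cl.
apply: (c_foldr (h := fun (_ : A) o r => if o is Some a then omap (cons a) r else None)
  cl (c_cst (Some [::]))).
have c2 := c_fst (c_snd
  (@c_id (pair_enc A (pair_enc (option_enc B) (option_enc (seq_enc B)))))).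
apply: (c_ocase (g := fun p b => omap (cons b) p.2.2) c2 (c_cst None)).
apply: (c_ocase (g := fun p s => Some (p.2 :: s)) (c_snd (c_snd (c_fst c_id))) (c_cst None)).
exact: (c_Some (c_cons (c_snd (c_fst c_id)) (c_snd c_id))).
Qed.

Lemma c_obind (A B C : encType) (o : A -> option B) (f : A -> B -> option C) :
  computable o -> computable (fun p => f p.1 p.2) ->
  computable (fun a => obind (f a) (o a)).
Proof. by move=> co cf; apply: (c_ocase co (c_cst None) cf). Qed.

Lemma c_eval_upto n (e : recfun n) :
  computable (fun p : nat * seq nat => eval_upto e p.1 p.2).
Proof.
elim: e => /= {n} [n||n i|m n g IHg h IHh|n g IHg h IHh|n g IHg].
- exact: (c_cst (Some 0)).
- exact: (c_Some (c_S (c_nth 0 (c_cst 0) (c_snd c_id)))).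
- exact: (c_Some (c_nth 0 (c_cst _) (c_snd c_id))).
- apply: (c_obind (f := fun p => eval_upto g p.1)).
    apply: c_all_some; elim: (enum 'I_m) => [|i l IH]; first exact: (c_cst [::]).
    exact: (c_cons (IHh i) IH).
  exact: (c_app2 IHg (c_fst (c_fst c_id)) (c_snd c_id)).
- apply: (c_natrec (h := fun p k r =>
    obind (fun u => eval_upto h p.1 [:: k, u & behead p.2]) r)).
  + exact: (c_nth 0 (c_cst 0) (c_snd c_id)).
  + exact: (c_app2 IHg (c_fst c_id) (c_behead (c_snd c_id))).
  apply: (c_obind (f := fun q u => eval_upto h q.1.1 [:: q.2.1, u & behead q.1.2])
     (c_snd (c_snd c_id))).
  apply: (c_app2 IHh (c_fst (c_fst (c_fst c_id)))).
  apply: (c_cons (c_fst (c_snd (c_fst c_id))) (c_cons (c_snd c_id) _)).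
  exact: (c_behead (c_snd (c_fst (c_fst c_id)))).
have cP : computable (fun p : nat * seq nat => find (fun k => 
    if eval_upto g p.1 (k :: p.2) is Some _.+1 then false else true) (iota 0 p.1)).
  apply: (c_find (P := fun p k =>
    if eval_upto g p.1 (k :: p.2) is Some _.+1 then false else true)
    (c_iota (c_fst c_id))).
  apply: (c_ocase (g := fun _ v => if v is _.+1 then false else true)
    (c_app2 IHg (c_fst (c_fst c_id)) (c_cons (c_snd c_id) (c_snd (c_fst c_id))))
    (c_cst true)).
  exact: (c_ncase (c_snd c_id) (c_cst true) (c_cst false)).
apply: (c_ocase (f := fun=> None) (g := fun p v => if v is _.+1 then None else Some
  (find (fun k => if eval_upto g p.1 (k :: p.2) is Some _.+1 then false else true)
     (iota 0 p.1)))
   (c_app2 IHg (c_fst c_id) (c_cons cP (c_snd c_id))) (c_cst None)).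
apply: (c_ncase (g := fun _ _ => None) (c_snd c_id) _ (c_cst None)).
exact: (c_Some (c_comp cP (c_fst c_id))).
Qed.

(** * Simulation of oracle machines *)

Canonical fin_enc.

(** Finite functions are encoded through the list of their values.  A table indexed by
    such functions uses the same code, which is why [c_fincase] accepts any injective
    code. *)
Lemma ffun_code_inj (I : finType) (T : encType) :
  injective (fun f : {ffun I -> T} => encode [seq f i | i <- enum I]).
Proof.
move=> f g /encode_inj /eq_in_map fg; apply/ffunP => i.
by apply: fg; rewrite mem_enum.
Qed.
Canonical ffun_enc (I : finType) (T : encType) := EncType (@ffun_code_inj I T).

Lemma c_ffun (A T : encType) (I : finType) (F : I -> A -> T) :
  (forall i, computable (F i)) -> computable (fun a => [ffun i => F i a]).
Proof.
move=> cF.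
have [r rr rP] : computable (fun a => [seq F i a | i <- enum I]).
  elim: (enum I) => [|i l IH]; first exact: (c_cst [::]).
  exact: (c_cons (cF i) IH).
exists r => // a; rewrite rP /=; congr seq_code.
by apply: eq_map => i; rewrite ffunE.
Qed.

Lemma c_ffapp (A T : encType) (x0 : T) (I : finType) (f : A -> {ffun I -> T}) i :
  computable f -> computable (fun a => f a i).
Proof.
move=> [r rr rP].
have cl : computable (fun a => [seq f a i | i <- enum I]) by exists r.
apply: c_ext (c_nth x0 (c_cst (index i (enum I))) cl) => a.
by rewrite (nth_map i) ?index_mem ?mem_enum // nth_index ?mem_enum.
Qed.

Lemma c_prefix (A : encType) (u s : A -> seq bool) : computable u -> computable s ->
  computable (fun a => prefix (u a) (s a)).
Proof.
move=> cu cs.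
apply: (@c_ext _ _ (fun a => (size (u a) <= size (s a)) &&
   (encode [seq nth false (s a) i | i <- iota 0 (size (u a))] == encode (u a)))).
  move=> a; rewrite prefixE.
  have -> (v w : seq bool) : (encode v == encode w) = (v == w).
    by apply/eqP/eqP => [/encode_inj|->].
  case: leqP => [us|su] /=; first by rewrite map_nth_iota0.
  apply/esym/negbTE/eqP => /(congr1 size).
  by rewrite take_oversize ?(ltnW su) // => E; rewrite E ltnn in su.
apply: (c_and (c_leq (c_size cu) (c_size cs))).
apply: c_eqn; last exact: c_encode cu.
apply/c_encode/(c_map (f := fun a => nth false (s a)) (c_iota (c_size cu))).
exact: (c_nth false (c_snd c_id) (c_comp cs (c_fst c_id))).
Qed.

Section Simulation.
Variable M : oracleTM.

Let sym_enc := option_enc (sum_enc bool_enc (fin_enc (aux M))).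
Let tape_enc := pair_enc (seq_enc sym_enc) (seq_enc sym_enc).
Let conf_enc := pair_enc (fin_enc (state M)) (ffun_enc 'I_(nwork M).+2 tape_enc).

Lemma c_leading_bits (A : encType) (l : A -> seq (symbol (aux M))) :
  computable l -> computable (fun a => leading_bits (l a)).
Proof.
move=> cl.
apply: (@c_ext _ _ (fun a => foldr (fun (o : symbol (aux M)) r =>
    if o is Some c then
      match c with inl b => b :: r | inr _ => [::] end else [::]) [::] (l a))).
  by move=> a; elim: (l a) => //= -[[b|c]|] s IH //=; rewrite IH.
apply: (c_foldr (h := fun _ (o : symbol (aux M)) r => if o is Some c then
      match c with inl b => b :: r | inr _ => [::] end else [::]) cl (c_cst [::])).
apply: (c_ocase (g := fun p (c : bool + aux M) =>
    match c with inl b => b :: p.2.2 | inr _ => [::] end)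
  (c_fst (c_snd c_id)) (c_cst [::])).
apply: (c_scase (f := fun p b => b :: p.1.2.2) (g := fun _ _ => [::])
  (c_snd c_id) _ (c_cst [::])).
exact: (c_cons (c_snd c_id) (c_snd (c_snd (c_fst (c_fst c_id))))).
Qed.

Lemma c_tape_move (A : encType) d (t : A -> tape (aux M)) :
  computable t -> computable (fun a => tape_move d (t a)).
Proof.
move=> ct; case: d => //=.
  apply: (c_pair (c_behead (c_fst ct))).
  exact: (c_cons (c_head None (c_fst ct)) (c_snd ct)).
apply: (c_pair (c_cons (c_head None (c_snd ct)) (c_fst ct))).
exact: (c_behead (c_snd ct)).
Qed.

(** For a fixed machine the control state and the scanned symbols range over finite types;
    once they are fixed the step is a fixed combination of list operations. *)
Lemma c_step (A : encType) (b : A -> seq bool -> bool) (c : A -> config M) :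
  computable (fun p => b p.1 p.2) -> computable c ->
  computable (fun a => step [set s | b a s] (c a)).
Proof.
move=> cb cc.
pose F q (a : A) := match state_role q with
  | Halt _ => c a
  | Query qyes qno => (if b a (query_string (c a)) then qyes else qno, (c a).2)
  | Act delta => let qa := delta [ffun i => tape_read ((c a).2 i)] in
      (qa.1, [ffun i => tape_move (qa.2 i).2 (tape_write (qa.2 i).1 ((c a).2 i))])
  end.
have ct i : computable (fun a => (c a).2 i).
  exact: (@c_ffapp _ tape_enc ([::], [::]) _ _ i (c_snd cc)).
apply: (@c_ext _ _ (fun a => F (c a).1 a)).
  by move=> a; rewrite /F /step; case: (state_role _) => // q q'; rewrite asboolb.
apply: (c_fincase (c_fst cc)) => q; rewrite /F.
case: (state_role q) => [_|q1 q2|delta] //.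
  apply: c_pair (c_snd cc).
  apply: (c_if _ (c_cst q1) (c_cst q2)).
  exact: (c_app2 cb c_id (c_leading_bits (c_snd (ct ord_max)))).
pose G (r : {ffun 'I_(nwork M).+2 -> symbol (aux M)}) (a : A) : config M :=
  let qa := delta r in
  (qa.1, [ffun i => tape_move (qa.2 i).2 (tape_write (qa.2 i).1 ((c a).2 i))]).
apply: (@c_fincase _ _ _ _ (@ffun_code_inj 'I_(nwork M).+2 sym_enc)
   (fun a => [ffun i => tape_read ((c a).2 i)]) G).
  by apply: c_ffun => i; exact: (c_head None (c_snd (ct i))).
move=> r; apply: (c_pair (c_cst _)); apply: c_ffun => i.
apply: c_tape_move.
exact: (c_pair (c_fst (ct i)) (c_cons (c_cst _) (c_behead (c_snd (ct i))))).
Qed.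

Definition halt_answer (q : state M) : option bool :=
  if state_role q is Halt b then Some b else None.

(** The oracle consists of the prefixes of s: this is what Pf(Omega) looks like to queries
    of length at most |s| when s is a prefix of the expansion. *)
Definition simulate (s x : seq bool) (t : nat) : option bool :=
  halt_answer (config_at M [set u | prefix u s] x t).1.

Lemma c_simulate :
  computable (fun p : seq bool * seq bool * nat => simulate p.1.1 p.1.2 p.2).
Proof.
apply: (@c_fincase _ _ _ _ (@enum_rank_code_inj (state M))
   (fun p : seq bool * seq bool * nat =>
   (config_at M [set u | prefix u p.1.1] p.1.2 p.2).1) (fun q _ => halt_answer q)).
  apply: (@c_fst _ (fin_enc (state M)) (ffun_enc 'I_(nwork M).+2 tape_enc)).
  refine (@c_iter (pair_enc (pair_enc (seq_enc bool_enc) (seq_enc bool_enc)) nat_enc)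
    conf_enc _ (fun p => init_config M p.1.2)
    (fun p => step [set u | prefix u p.1.1]) (c_snd c_id) _ _).
    apply: (c_pair (c_cst _)); apply: c_ffun => i.
    apply: (c_pair (c_cst [::])).
    case: (i == ord0); last exact: (c_cst [::]).
    apply: (c_map (f := fun _ b => Some (inl b)) (c_snd (c_fst c_id))).
    exact: (c_Some (c_inl _ (c_snd c_id))).
  apply: (c_step (b := fun p u => prefix u p.1.1.1) _ (c_snd c_id)).
  exact: (c_prefix (c_snd c_id) (c_fst (c_fst (c_fst (c_fst c_id))))).
by move=> q; exact: c_cst.
Qed.
End Simulation.

(** * Structured tape programs as oracle machines *)

Definition stream := nat -> symbol void.
(** A tape up to trailing blanks, as the cells left of the head, nearest first, and those
    from the head rightwards.  Rewriting the scanned symbol leaves such a tape equal to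
    itself, which fails for pairs of finite lists. *)
Definition stape := (stream * stream)%type.

Definition smove (d : move) (t : stape) : stape :=
  match d with
  | MoveLeft => (fun i => t.1 i.+1, fun i => if i is j.+1 then t.2 j else t.1 0)
  | MoveRight => (fun i => if i is j.+1 then t.1 j else t.2 0, fun i => t.2 i.+1)
  | Stay => t
  end.

Definition swrite (a : symbol void) (t : stape) : stape :=
  (t.1, fun i => if i is 0 then a else t.2 i).

Definition stream_tape (t : tape void) : stape := (nth None t.1, nth None t.2).

Lemma stream_tape_move d t : stream_tape (tape_move d t) = smove d (stream_tape t).
Proof.
by case: t => l r; case: d => //; rewrite /stream_tape /smove /=; congr pair;
  apply/funext => -[|i] //=; rewrite ?nth_behead // nth0.
Qed.

Lemma stream_tape_write a t : stream_tape (tape_write a t) = swrite a (stream_tape t).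
Proof.
case: t => l r; congr pair; apply/funext => -[|i] //=.
by rewrite nth_behead.
Qed.

Lemma swrite_read t : swrite (t.2 0) t = t.
Proof. by case: t => l r; congr pair; apply/funext => -[]. Qed.

(** Each test inspects the symbol scanned on one tape.  Tape 0 is the input tape and tape 1
    the query tape; the others are work tapes. *)
Inductive tcmd :=
| TAct (i : nat) (d : symbol void -> symbol void * move)
| TSkip
| TSeq (c1 c2 : tcmd)
| TWhile (i : nat) (P : symbol void -> bool) (c : tcmd)
| TIf (i : nat) (P : symbol void -> bool) (c1 c2 : tcmd)
| TQuery (c1 c2 : tcmd).

Definition store := nat -> stape.
Definition sread (st : store) i : symbol void := (st i).2 0.
Definition supd (st : store) i t : store := fun j => if j == i then t else st j.
Definition sact (d : symbol void -> symbol void * move) (t : stape) : stape :=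
  smove (d (t.2 0)).2 (swrite (d (t.2 0)).1 t).

Definition bits (s : seq bool) : seq (symbol void) := [seq Some (inl b) | b <- s].

Section Exec.
Variables (B : set (seq bool)) (L : nat).

(** The rule for queries excludes those longer than L, so that the length bound holds along
    every execution without a separate invariant. *)
Inductive texec : tcmd -> store -> store -> Prop :=
| XAct i d st : texec (TAct i d) st (supd st i (sact d (st i)))
| XSkip st : texec TSkip st st
| XSeq c1 c2 st st1 st2 : texec c1 st st1 -> texec c2 st1 st2 ->
    texec (TSeq c1 c2) st st2
| XWhileF i (P : symbol void -> bool) c st : P (sread st i) = false ->
    texec (TWhile i P c) st st
| XWhileT i (P : symbol void -> bool) c st st1 st2 : P (sread st i) -> texec c st st1 ->
    texec (TWhile i P c) st1 st2 -> texec (TWhile i P c) st st2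
| XIf i (P : symbol void -> bool) c1 c2 st st1 :
    texec (if P (sread st i) then c1 else c2) st st1 ->
    texec (TIf i P c1 c2) st st1
| XQuery l s c1 c2 st st1 : st 1 = stream_tape (l, bits s) -> size s <= L ->
    texec (if `[< B s >] then c1 else c2) st st1 -> texec (TQuery c1 c2) st st1.
End Exec.

Lemma leading_bits_stream (r : seq (symbol void)) s : nth None r =1 nth None (bits s) ->
  leading_bits r = s.
Proof.
elim: r s => [|a r IH] [|b s] //= E; have := E 0 => //=.
  by move->.
move=> ->; congr cons; apply: IH => i; exact: (E i.+1).
Qed.

Fixpoint code_length c := match c with
  | TAct _ _ => 1
  | TSkip => 0
  | TSeq c1 c2 => code_length c1 + code_length c2
  | TWhile _ _ c => (code_length c).+2
  | TIf _ _ c1 c2 | TQuery c1 c2 => (code_length c1 + code_length c2).+2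
  end.

Fixpoint tapes_used c := match c with
  | TAct i _ => i.+1
  | TSkip => 0
  | TSeq c1 c2 | TQuery c1 c2 => maxn (tapes_used c1) (tapes_used c2)
  | TWhile i _ c => maxn i.+1 (tapes_used c)
  | TIf i _ c1 c2 => maxn i.+1 (maxn (tapes_used c1) (tapes_used c2))
  end.

Inductive instr :=
| IAct (i : nat) (d : symbol void -> symbol void * move)
| IUnless (i : nat) (P : symbol void -> bool) (a : nat)
| IJump (a : nat)
| IQuery (a : nat)
| IHalt (b : bool).

(** The offset o of the block in the final program makes all jump addresses absolute. *)
Fixpoint assemble (o : nat) (c : tcmd) : seq instr := match c with
  | TAct i d => [:: IAct i d]
  | TSkip => [::]
  | TSeq c1 c2 => assemble o c1 ++ assemble (o + code_length c1) c2
  | TWhile i P c => IUnless i P (o + (code_length c).+2) :: assemble o.+1 c ++ [:: IJump o]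
  | TIf i P c1 c2 => IUnless i P (o + (code_length c1).+2) ::
      assemble o.+1 c1 ++ IJump (o + (code_length c1 + code_length c2).+2) ::
      assemble (o + (code_length c1).+2) c2
  | TQuery c1 c2 => IQuery (o + (code_length c1).+2) ::
      assemble o.+1 c1 ++ IJump (o + (code_length c1 + code_length c2).+2) ::
      assemble (o + (code_length c1).+2) c2
  end.

Lemma size_assemble o c : size (assemble o c) = code_length c.
Proof.
elim: c o => //= [c1 IH1 c2 IH2|i P c IH|i P c1 IH1 c2 IH2|c1 IH1 c2 IH2] o;
  rewrite size_cat ?IH1 ?IH2 ?IH //= ?IH2 ?addnS ?addn0 //.
Qed.

Section Machine.
Variables (prog : seq instr) (nw : nat).

Definition tape_index (i : nat) : 'I_nw.+2 :=
  match i with 0 => ord0 | 1 => ord_max | j.+2 => inord j.+1 end.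

Lemma tape_index_inj i j : i < nw.+2 -> j < nw.+2 ->
  tape_index i = tape_index j -> i = j.
Proof.
case: i => [|[|i]]; case: j => [|[|j]] //= ilt jlt /(congr1 val) /=;
  rewrite ?inordK //; lia.
Qed.

Definition instr_role (q : 'I_(size prog).+1) :
    role 'I_(size prog).+1 void nw.+2 :=
  match nth (IHalt false) prog q with
  | IAct i d => Act (fun r => (inord q.+1,
      [ffun j => if j == tape_index i then d (r j) else (r j, Stay)]))
  | IUnless i P a => Act (fun r =>
      (inord (if P (r (tape_index i)) then q.+1 else a), [ffun j => (r j, Stay)]))
  | IJump a => Act (fun r => (inord a, [ffun j => (r j, Stay)]))
  | IQuery a => Query (inord q.+1) (inord a)
  | IHalt b => Halt b
  end.

Definition machine : oracleTM := @OracleTM 'I_(size prog).+1 void nw ord0 instr_role.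

(** Only the tapes up to blanks are compared, and only those that the program uses. *)
Definition represents (c : config machine) (pc : nat) (st : store) :=
  nat_of_ord (c.1 : 'I_(size prog).+1) = pc /\
  forall i, i < nw.+2 -> stream_tape (c.2 (tape_index i)) = st i.

Variables (B : set (seq bool)) (L : nat).

Definition safe (c : config machine) := forall q1 q2,
  state_role c.1 = Query q1 q2 -> size (query_string c) <= L.

Definition safe_run c t := forall t', t' < t -> safe (iter t' (step B) c).

Lemma safe_runD c t u : safe_run c t -> safe_run (iter t (step B) c) u ->
  safe_run c (u + t).
Proof.
move=> h1 h2 t' lt; case: (ltnP t' t) => [/h1 //|tt'].
have -> : t' = (t' - t) + t by rewrite subnK.
by rewrite iterD; apply: h2; lia.
Qed.

Lemma tape_read_stream (t : tape void) : tape_read t = (stream_tape t).2 0.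
Proof. by rewrite /tape_read /= nth0. Qed.

Lemma idle_stream (t : tape void) :
  stream_tape (tape_move Stay (tape_write (tape_read t) t)) = stream_tape t.
Proof. by rewrite stream_tape_move stream_tape_write tape_read_stream swrite_read. Qed.

Lemma step_act c pc st i d : represents c pc st -> pc < size prog ->
  nth (IHalt false) prog pc = IAct i d -> i < nw.+2 ->
  represents (step B c) pc.+1 (supd st i (sact d (st i))) /\ safe c.
Proof.
move=> [cpc cst] pclt E ilt; rewrite /safe /step /= /instr_role cpc E; split => //.
split=> [|j jlt] /=; first by rewrite inordK.
rewrite !ffunE /supd; case: eqP => [/tape_index_inj-> //|ne].
  rewrite eqxx stream_tape_move stream_tape_write tape_read_stream.
  by rewrite /sact cst.
case: eqP => [ji|_]; first by rewrite ji in ne.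
by rewrite idle_stream cst.
Qed.

Lemma step_unless c pc st i P a : represents c pc st -> pc < size prog ->
  a <= size prog ->
  nth (IHalt false) prog pc = IUnless i P a -> i < nw.+2 ->
  represents (step B c) (if P (sread st i) then pc.+1 else a) st /\ safe c.
Proof.
move=> [cpc cst] pclt ale E ilt; rewrite /safe /step /= /instr_role cpc E; split => //.
split=> [|j jlt] /=.
  rewrite ffunE tape_read_stream cst // /sread.
  by case: (P _); rewrite inordK.
by rewrite !ffunE idle_stream cst.
Qed.

Lemma step_jump c pc st a : represents c pc st -> a <= size prog ->
  nth (IHalt false) prog pc = IJump a ->
  represents (step B c) a st /\ safe c.
Proof.
move=> [cpc cst] ale E; rewrite /safe /step /= /instr_role cpc E; split => //.
split=> [|j jlt] /=; first by rewrite inordK.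
by rewrite !ffunE idle_stream cst.
Qed.

Lemma step_query c pc st a l s : represents c pc st -> pc < size prog ->
  a <= size prog ->
  nth (IHalt false) prog pc = IQuery a ->
  st 1 = stream_tape (l, bits s) -> size s <= L ->
  represents (step B c) (if `[< B s >] then pc.+1 else a) st /\ safe c.
Proof.
move=> [cpc cst] pclt ale E st1 sL.
have qs : query_string c = s.
  apply: leading_bits_stream => i.
  by have /(congr1 snd) /= -> := etrans (cst 1 isT) st1.
rewrite /safe /step /= /instr_role cpc E qs; split => //.
by split=> //=; case: ifP => _; rewrite inordK.
Qed.

Definition leads_to pc st pc' st' := forall c, represents c pc st ->
  exists t, represents (iter t (step B) c) pc' st' /\ safe_run c t.

Lemma leads_to_refl pc st : leads_to pc st pc st.
Proof. by move=> c rep; exists 0. Qed.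

Lemma leads_to_trans pc1 st1 pc2 st2 pc3 st3 :
  leads_to pc1 st1 pc2 st2 -> leads_to pc2 st2 pc3 st3 -> leads_to pc1 st1 pc3 st3.
Proof.
move=> s12 s23 c /s12 [t [/s23 [u [rep safe2]] safe1]].
by exists (u + t); split; [rewrite iterD|apply: safe_runD].
Qed.

Lemma leads_to1 pc st pc' st' : (forall c, represents c pc st ->
  represents (step B c) pc' st' /\ safe c) -> leads_to pc st pc' st'.
Proof. by move=> h c /h [rep sf]; exists 1; split=> // -[]. Qed.

Definition located o l := exists post, drop o prog = l ++ post.

Lemma located_cat o l1 l2 : located o (l1 ++ l2) ->
  located o l1 /\ located (o + size l1) l2.
Proof.
move=> [post E]; split; first by exists (l2 ++ post); rewrite E catA.
by exists post; rewrite addnC -drop_drop E -catA drop_size_cat.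
Qed.

Lemma located_cons o x l : located o (x :: l) ->
  [/\ nth (IHalt false) prog o = x, located o.+1 l & o + (size l).+1 <= size prog].
Proof.
move=> loc; have [post E] := loc.
have lt : o + (size l).+1 <= size prog.
  have := congr1 size E; rewrite size_drop /= size_cat; lia.
split => //; last by have [_] := @located_cat o [:: x] l loc; rewrite /= addn1.
by have := congr1 (nth (IHalt false) ^~ 0) E; rewrite /= nth_drop addn0.
Qed.

(** By induction on the execution; safety of the queries is carried along, so that the bound
    on the query size holds at all times and not merely at the end. *)
Lemma assemble_leads_to c st st' : texec B L c st st' ->
  forall o, located o (assemble o c) -> tapes_used c <= nw.+2 ->
  leads_to o st (o + code_length c) st'.
Proof.
elim=> {c st st'} /=.
- move=> i d st o /located_cons [E _ lt] ilt; apply: leads_to1 => c rep.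
  by rewrite addn1; apply: step_act => //; rewrite addn1 in lt.
- by move=> st o _ _; rewrite addn0; apply: leads_to_refl.
- move=> c1 c2 st st1 st2 _ IH1 _ IH2 o /located_cat [loc1 loc2].
  rewrite geq_max => /andP[lt1 lt2].
  rewrite size_assemble in loc2; rewrite addnA.
  exact: leads_to_trans (IH1 _ loc1 lt1) (IH2 _ loc2 lt2).
- move=> i P c st Pf o /located_cons [E _]; rewrite size_cat size_assemble addn1 => lt.
  rewrite geq_max => /andP[ilt _]; apply: leads_to1 => cfg rep.
  have o1 : o < size prog by lia.
  by have := step_unless rep o1 lt E ilt; rewrite Pf.
- move=> i P c st st1 st2 Pt _ IH1 _ IH2 o loc /[dup] bnd.
  have /located_cons [E loc1] := loc; rewrite size_cat size_assemble addn1 => lt.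
  rewrite geq_max => /andP[ilt clt].
  have [loc2 /located_cons [E' _ _]] := located_cat loc1; rewrite size_assemble in E'.
  have o1 : o < size prog by lia.
  apply: (@leads_to_trans _ _ o.+1 st).
    by apply: leads_to1 => cfg rep; have := step_unless rep o1 lt E ilt; rewrite Pt.
  apply: leads_to_trans (IH1 _ loc2 clt) _.
  apply: leads_to_trans (IH2 _ loc bnd).
  by apply: leads_to1 => cfg rep; apply: (step_jump rep) => //; lia.
- move=> i P c1 c2 st st1 _ IH o /located_cons [E loc].
  rewrite size_cat /= !size_assemble => lt.
  have [loc1 /located_cons [E' loc2 _]] := located_cat loc.
  rewrite size_assemble in E' loc2; rewrite !geq_max => /and3P[ilt lt1 lt2].
  have o1 : o < size prog by lia.
  have s0 : leads_to o st (if P (sread st i) then o.+1 else o + (code_length c1).+2) st.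
    by apply: leads_to1 => cfg rep; apply: (step_unless rep) => //; lia.
  apply: (leads_to_trans s0); case: (P _) IH {s0} => IH.
    apply: (leads_to_trans (IH _ loc1 lt1)).
    by apply: leads_to1 => cfg rep; apply: (step_jump rep) => //; lia.
  have e : (o.+1 + code_length c1).+1 = o + (code_length c1).+2 by lia.
  rewrite e in loc2.
  have -> : o + (code_length c1 + code_length c2).+2 =
  o + (code_length c1).+2 + code_length c2 by lia.
  exact: IH.
move=> l s c1 c2 st st1 st1E sL _ IH o /located_cons [E loc].
rewrite size_cat /= !size_assemble => lt.
have [loc1 /located_cons [E' loc2 _]] := located_cat loc.
rewrite size_assemble in E' loc2; rewrite !geq_max => /andP[lt1 lt2].
have o1 : o < size prog by lia.
have s0 : leads_to o st (if `[< B s >] then o.+1 else o + (code_length c1).+2) st.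
  by apply: leads_to1 => cfg rep; apply: (step_query rep _ _ E st1E) => //; lia.
apply: (leads_to_trans s0); case: (`[< _ >]) IH {s0} => IH.
  apply: (leads_to_trans (IH _ loc1 lt1)).
  by apply: leads_to1 => cfg rep; apply: (step_jump rep) => //; lia.
have e : (o.+1 + code_length c1).+1 = o + (code_length c1).+2 by lia.
rewrite e in loc2.
have -> : o + (code_length c1 + code_length c2).+2 =
  o + (code_length c1).+2 + code_length c2 by lia.
exact: IH.
Qed.

End Machine.

Definition init_store (x : seq bool) : store :=
  fun i => stream_tape ([::], if i == 0 then bits x else [::]).

(** After the program, a test of the symbol scanned on tape [out] selects one of the two
    halting instructions.  A halted configuration no longer changes, so no query occurs
    later. *)
Lemma machine_of_cmd (c : tcmd) (out : nat) (P : symbol void -> bool)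
    (A B : set (seq bool)) (L : seq bool -> nat) :
  (forall x, exists2 st, texec B (L x) c (init_store x) st &
     P (sread st out) = `[< A x >]) ->
  exists M : oracleTM, reduces_via M A B /\
    forall x s, queries M B x s -> size s <= L x.
Proof.
move=> H.
pose prog := assemble 0 c ++
  [:: IUnless out P (code_length c).+2; IHalt true; IHalt false].
pose nw := maxn (tapes_used c) out.+1.
have tc : tapes_used c <= nw.+2 by rewrite /nw; lia.
have oc : out < nw.+2 by rewrite /nw; lia.
have szp : size prog = code_length c + 3 by rewrite size_cat size_assemble.
have loc : located prog 0 prog by exists [::]; rewrite drop0 cats0.
have [loc1 loc2] := located_cat loc.
rewrite add0n size_assemble in loc2.
have [E1 /located_cons [E2 /located_cons [E3 _ _] _] lt] := located_cons loc2.
have fin x : exists t, state_role (config_at (machine prog nw) B x t).1 = Halt `[< A x >]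
    /\ safe_run B (L x) (init_config (machine prog nw) x) t.
  have [st ex Pst] := H x.
  have rep0 : represents (init_config (machine prog nw) x) 0 (init_store x).
    split=> // i ilt; rewrite /= ffunE /init_store.
    have -> // : (tape_index nw i == ord0) = (i == 0).
    by apply/eqP/eqP => [e|->//]; apply: (@tape_index_inj nw i 0).
  have sg : leads_to prog nw B (L x) 0 (init_store x)
      (if `[< A x >] then (code_length c).+1 else (code_length c).+2) st.
    apply: leads_to_trans (assemble_leads_to ex loc1 tc) _.
    rewrite add0n; apply: leads_to1 => cfg rep.
    have lt1 : code_length c < size prog by lia.
    have lt2 : (code_length c).+2 <= size prog by lia.
    by have := step_unless B (L x) rep lt1 lt2 E1 oc; rewrite Pst.
  have [t [rep sf]] := sg _ rep0; exists t; split=> //.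
  by rewrite /= /instr_role rep.1; case: `[< _ >]; rewrite ?E2 ?E3.
exists (machine prog nw); split=> [x|x s [t [q1 [q2 [qr ->]]]]].
  by have [t [hlt _]] := fin x; exists t.
have [t0 [hlt sf]] := fin x.
case: (ltnP t t0) => [/sf /(_ _ _ qr) //|tt].
have := qr; rewrite -(subnK tt) /config_at iterD.
have -> u : iter u (step B) (config_at (machine prog nw) B x t0) =
    config_at (machine prog nw) B x t0.
  by elim: u => //= u ->; rewrite {1}/step hlt.
by rewrite hlt.
Qed.

(** * Unary counters and compilation of recursive functions *)

Definition isone (a : symbol void) : bool := if a is Some (inl b) then b else false.

(** The value is the number of consecutive ones starting at the head; what lies beyond
    the first other symbol, or left of the head, is arbitrary.  Decrementing is a move to
    the right and incrementing a move to the left followed by writing a one. *)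
Definition holds_counter (t : stape) v :=
  (forall i, i < v -> isone (t.2 i)) /\ isone (t.2 v) = false.

Definition upd (rho : nat -> nat) r v := fun r' => if r' == r then v else rho r'.

Definition cinc r := TSeq (TAct r.+2 (fun a => (a, MoveLeft)))
  (TAct r.+2 (fun _ => (Some (inl true), Stay))).
Definition cdec r := TAct r.+2 (fun a => (a, MoveRight)).
Definition cwhile r c := TWhile r.+2 isone c.

Lemma rec_graph_fun n (e : recfun n) xs y y' :
  rec_graph e xs y -> rec_graph e xs y' -> y = y'.
Proof.
move=> /eval_uptoP [s sy] /eval_uptoP [t ty].
have := eval_upto_mono (leq_maxl s t) sy.
by rewrite (eval_upto_mono (leq_maxr s t) ty) => -[].
Qed.

Lemma primrec_graph_fun (G : nat -> Prop) (H : nat -> nat -> nat -> Prop) k v v' :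
  (forall a b, G a -> G b -> a = b) ->
  (forall i u a b, H i u a -> H i u b -> a = b) ->
  primrec_graph G H k v -> primrec_graph G H k v' -> v = v'.
Proof.
move=> Gf Hf; elim: k v v' => [|k IH] v v' /=; first exact: Gf.
move=> [u ku Hu] [u' ku' Hu']; move: Hu'; rewrite -(IH _ _ ku ku'); exact: Hf.
Qed.

Lemma primrec_graph_down (G : nat -> Prop) (H : nat -> nat -> nat -> Prop) j k v :
  primrec_graph G H (j + k) v -> exists u, primrec_graph G H k u.
Proof.
by elim: j v => [|j IH] v; [exists v|move=> /= [u /IH]].
Qed.

Section Counters.
Variables (B : set (seq bool)) (L : nat).

Definition counters (st : store) (rho : nat -> nat) :=
  forall r, holds_counter (st r.+2) (rho r).

Definition postcond := (nat -> nat) -> stape -> stape -> Prop.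

(** A total-correctness specification in weakest-precondition form: from counters rho, input
    tape t0 and query tape t1, the program c terminates in a situation satisfying Q. *)
Definition run c rho t0 t1 (Q : postcond) := forall st,
  counters st rho -> st 0 = t0 -> st 1 = t1 ->
  exists st' rho', [/\ texec B L c st st', counters st' rho' & Q rho' (st' 0) (st' 1)].

Lemma run_skip rho t0 t1 (Q : postcond) : Q rho t0 t1 -> run TSkip rho t0 t1 Q.
Proof.
by move=> q st cs e0 e1; exists st, rho; rewrite e0 e1; split=> //; apply: XSkip.
Qed.

Lemma run_seq c1 c2 rho t0 t1 (Q : postcond) :
  run c1 rho t0 t1 (fun r u v => run c2 r u v Q) -> run (TSeq c1 c2) rho t0 t1 Q.
Proof.
move=> h st c0 e0 e1; have [st1 [r1 [ex1 c1' q]]] := h st c0 e0 e1.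
have [st2 [r2 [ex2 c2' q2]]] := q st1 c1' erefl erefl.
by exists st2, r2; split=> //; apply: XSeq ex1 ex2.
Qed.

Lemma counters_upd st rho r t v : counters st rho -> holds_counter t v ->
  counters (supd st r.+2 t) (upd rho r v).
Proof.
by move=> cs ht r'; rewrite /supd /upd !eqSS; case: eqP.
Qed.

Lemma run_inc r rho t0 t1 (Q : postcond) : Q (upd rho r (rho r).+1) t0 t1 ->
  run (cinc r) rho t0 t1 Q.
Proof.
move=> q st cs e0 e1.
exists (supd (supd st r.+2 (smove MoveLeft (st r.+2))) r.+2
   (swrite (Some (inl true)) (smove MoveLeft (st r.+2)))), (upd rho r (rho r).+1).
split.
- have -> : smove MoveLeft (st r.+2) = sact (fun a => (a, MoveLeft)) (st r.+2).
    by rewrite /sact swrite_read.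
  apply: XSeq; first exact: XAct.
  set st1 := supd _ _ _.
  have E : swrite (Some (inl true)) (sact (fun a => (a, MoveLeft)) (st r.+2))
     = sact (fun _ => (Some (inl true), Stay)) (st1 r.+2).
    by rewrite {2}/sact /= /st1 /supd eqxx.
  by rewrite E; apply: XAct.
- have [h1 h2] := cs r.
  move=> r'; rewrite /supd /upd !eqSS; case: eqP => // _.
  by split=> [[|i]|] //=; apply: h1.
by rewrite /supd /= e0 e1.
Qed.

Lemma run_dec r rho t0 t1 v (Q : postcond) : rho r = v.+1 -> Q (upd rho r v) t0 t1 ->
  run (cdec r) rho t0 t1 Q.
Proof.
move=> rv q st cs e0 e1.
exists (supd st r.+2 (sact (fun a => (a, MoveRight)) (st r.+2))), (upd rho r v).
split; first exact: XAct.
  apply: counters_upd => //; rewrite /sact swrite_read /=.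
  have [h1 h2] := cs r; rewrite rv in h1 h2.
  by split=> [i iv|]; [exact: (h1 i.+1 iv)|exact: h2].
by rewrite /supd /= e0 e1.
Qed.

Lemma counter_read st rho r : counters st rho -> isone (sread st r.+2) = (0 < rho r).
Proof.
move=> /(_ r) [h1 h2]; rewrite /sread; case: (rho r) h1 h2 => [_ -> //|v h1 _].
exact: h1.
Qed.

Lemma run_while_end r c rho t0 t1 (Q : postcond) : rho r = 0 -> Q rho t0 t1 ->
  run (cwhile r c) rho t0 t1 Q.
Proof.
move=> r0 q st cs e0 e1; exists st, rho; split=> //; last by rewrite e0 e1.
by apply: XWhileF; rewrite (counter_read r cs) r0.
Qed.

Lemma run_while_step r c rho t0 t1 (Q : postcond) : 0 < rho r ->
  run c rho t0 t1 (fun r1 u v => run (cwhile r c) r1 u v Q) ->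
  run (cwhile r c) rho t0 t1 Q.
Proof.
move=> r0 h st cs e0 e1; have [st1 [r1 [ex1 c1 q]]] := h st cs e0 e1.
have [st2 [r2 [ex2 c2 q2]]] := q st1 c1 erefl erefl.
exists st2, r2; split=> //; apply: XWhileT ex1 ex2.
by rewrite (counter_read r cs).
Qed.

Definition cclear r := cwhile r (cdec r).

Lemma run_clear r rho t0 t1 (Q : postcond) : Q (upd rho r 0) t0 t1 ->
  run (cclear r) rho t0 t1 Q.
Proof.
move: {2}(rho r) (erefl (rho r)) => n; elim: n rho => [|n IH] rho rn q.
  apply: run_while_end => //; suff <- : upd rho r 0 = rho by [].
  by apply/funext => r'; rewrite /upd; case: eqP => // ->.
apply: run_while_step; first by rewrite rn.
apply: (run_dec rn); apply: IH; first by rewrite /upd eqxx.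
suff -> : upd (upd rho r n) r 0 = upd rho r 0 by [].
by apply/funext => r'; rewrite /upd; case: eqP.
Qed.

(** The value of s is consumed and added to both d and e; two copies are made because moving
    the second one back restores s. *)
Lemma run_transfer s d e rho t0 t1 (Q : postcond) : s != d -> s != e -> d != e ->
  (forall rho', rho' s = 0 -> rho' d = rho d + rho s -> rho' e = rho e + rho s ->
     (forall r, r != s -> r != d -> r != e -> rho' r = rho r) -> Q rho' t0 t1) ->
  run (cwhile s (TSeq (cdec s) (TSeq (cinc d) (cinc e)))) rho t0 t1 Q.
Proof.
move=> sd se de; move: {2}(rho s) (erefl (rho s)) => n.
elim: n rho => [|n IH] rho rn q.
  by apply: run_while_end => //; apply: q => //; rewrite rn addn0.
apply: run_while_step; first by rewrite rn.
apply/run_seq/(run_dec rn)/run_seq/run_inc/run_inc/IH.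
  by rewrite /upd (negPf se) (negPf sd) eqxx.
move=> rho' h1 h2 h3 h4; apply: q => //.
- rewrite h2 /upd eqxx [s == e](negPf se) [s == d](negPf sd) eqxx (negPf de).
  by rewrite [d == s]eq_sym (negPf sd) rn; lia.
- rewrite h3 /upd eqxx [s == e](negPf se) [s == d](negPf sd) eqxx.
  by rewrite ![e == _]eq_sym (negPf de) (negPf se) rn; lia.
by move=> r rs rd re; rewrite h4 // /upd (negPf rs) (negPf rd) (negPf re).
Qed.

Definition ccopy s d e := TSeq (TSeq (cclear d) (cclear e))
  (TSeq (cwhile s (TSeq (cdec s) (TSeq (cinc d) (cinc e))))
        (cwhile e (TSeq (cdec e) (cinc s)))).

Lemma run_move s d rho t0 t1 (Q : postcond) : s != d ->
  (forall rho', rho' s = 0 -> rho' d = rho d + rho s ->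
     (forall r, r != s -> r != d -> rho' r = rho r) -> Q rho' t0 t1) ->
  run (cwhile s (TSeq (cdec s) (cinc d))) rho t0 t1 Q.
Proof.
move=> sd; move: {2}(rho s) (erefl (rho s)) => n.
elim: n rho => [|n IH] rho rn q.
  by apply: run_while_end => //; apply: q => //; rewrite rn addn0.
apply: run_while_step; first by rewrite rn.
apply/run_seq/(run_dec rn)/run_inc/IH; first by rewrite /upd (negPf sd) eqxx.
move=> rho' h1 h2 h3; apply: q => //.
  by rewrite h2 /upd eqxx [s == d](negPf sd) eqxx [d == s]eq_sym (negPf sd) rn; lia.
by move=> r rs rd; rewrite h3 // /upd (negPf rs) (negPf rd).
Qed.

Lemma run_copy s d e rho t0 t1 (Q : postcond) : s != d -> s != e -> d != e ->
  (forall rho', rho' d = rho s -> (forall r, r != d -> r != e -> rho' r = rho r) ->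
     Q rho' t0 t1) ->
  run (ccopy s d e) rho t0 t1 Q.
Proof.
move=> sd se de q; apply/run_seq/run_seq/run_clear/run_clear/run_seq.
apply: run_transfer => // r1 h1 h2 h3 h4.
apply: run_move => [|r2 k1 k2 k3]; first by rewrite eq_sym.
have ds : d != s by rewrite eq_sym.
have es : e != s by rewrite eq_sym.
have ed : e != d by rewrite eq_sym.
move: h2 h3; rewrite /upd !eqxx (negPf de) (negPf se) (negPf sd) !add0n => h2 h3.
apply: q; first by rewrite k3.
move=> r rd re; have [->|rs] := eqVneq r s; first by rewrite k2 h1 h3.
by rewrite k3 // h4 // /upd (negPf rd) (negPf re).
Qed.

Definition cdouble r e := TSeq (cclear e)
  (TSeq (cwhile r (TSeq (cdec r) (TSeq (cinc e) (cinc e)))) 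
     (cwhile e (TSeq (cdec e) (cinc r)))).

Lemma run_double r e rho t0 t1 (Q : postcond) : r != e ->
  (forall rho', rho' r = (rho r).*2 -> (forall i, i != r -> i != e -> rho' i = rho i) ->
     Q rho' t0 t1) ->
  run (cdouble r e) rho t0 t1 Q.
Proof.
move=> re q; apply/run_seq/run_clear/run_seq.
have er : e != r by rewrite eq_sym.
have T rho1 (Q' : postcond) : (forall rho', rho' r = 0 -> rho' e = rho1 e + (rho1 r).*2 ->
     (forall i, i != r -> i != e -> rho' i = rho1 i) -> Q' rho' t0 t1) ->
   run (cwhile r (TSeq (cdec r) (TSeq (cinc e) (cinc e)))) rho1 t0 t1 Q'.
  move: {2}(rho1 r) (erefl (rho1 r)) => n.
  elim: n rho1 => [|n IH] rho1 rn q'.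
    by apply: run_while_end => //; apply: q' => //; rewrite rn addn0.
  apply: run_while_step; first by rewrite rn.
  apply/run_seq/(run_dec rn)/run_seq/run_inc/run_inc/IH.
    by rewrite /upd (negPf re) eqxx.
  move=> rho' h1 h2 h3; apply: q' => //.
    by rewrite h2 /upd eqxx [r == e](negPf re) eqxx (negPf er) rn; lia.
  by move=> i ir ie; rewrite h3 // /upd (negPf ie) (negPf ir).
apply: T => r1 h1 h2 h3; apply: run_move => // r2 k1 k2 k3.
move: h2; rewrite /upd eqxx (negPf re) add0n => h2.
apply: q; first by rewrite k2 h1 h2.
by move=> i ir ie; rewrite k3 // h3 // /upd (negPf ie).
Qed.

Fixpoint cseqs (cs : seq tcmd) : tcmd :=
  if cs is c :: cs' then TSeq c (cseqs cs') else TSkip.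

(** The values of the arguments are in the registers [ins], the result goes to [out] and
    the registers from [fr] on are free for intermediate results. *)
Fixpoint compile n (e : recfun n) (ins : seq nat) (out fr : nat) : tcmd :=
  match e with
  | Zero _ => cclear out
  | Succ => TSeq (ccopy (nth 0 ins 0) out fr) (cinc out)
  | Proj _ i => ccopy (nth 0 ins i) out fr
  | Comp m _ g h => TSeq
      (cseqs [seq compile (h i) ins (fr + i) (fr + m) | i <- enum 'I_m])
      (compile g (iota fr m) out (fr + m))
  | PrimRec _ g h =>
      TSeq (ccopy (nth 0 ins 0) fr.+2 fr)
     (TSeq (compile g (behead ins) fr fr.+4)
     (TSeq (cclear fr.+1)
     (TSeq (cwhile fr.+2 (TSeq (cdec fr.+2)
             (TSeq (compile h [:: fr.+1, fr & behead ins] fr.+3 fr.+4)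
             (TSeq (ccopy fr.+3 fr fr.+4) (cinc fr.+1)))))
        (ccopy fr out fr.+4))))
  | Mu _ g =>
      TSeq (cclear fr)
     (TSeq (compile g (fr :: ins) fr.+1 fr.+2)
     (TSeq (cwhile fr.+1 (TSeq (cinc fr) (compile g (fr :: ins) fr.+1 fr.+2)))
        (ccopy fr out fr.+1)))
  end.

Definition compile_spec n (e : recfun n) := forall (xs : n.-tuple nat) y,
  rec_graph e xs y -> forall ins out fr rho t0 t1 (Q : postcond),
  size ins = n -> all (fun r => (r < fr) && (r != out)) ins -> out < fr ->
  [seq rho r | r <- ins] = xs ->
  (forall rho', rho' out = y -> (forall r, r < fr -> r != out -> rho' r = rho r) ->
     Q rho' t0 t1) ->
  run (compile e ins out fr) rho t0 t1 Q.

(** By induction on e.  Registers below [fr] other than [out] are preserved; the free ones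
    may contain anything at the start, so each routine clears those it uses. *)
Lemma compileP n (e : recfun n) : compile_spec e.
Proof.
elim: e => {n} [n||n i|m n g IHg h IHh|n g IHg h IHh|n g IHg] xs y /=.
- move=> -> ins out fr rho t0 t1 Q _ _ _ _ q; apply: run_clear; apply: q.
    by rewrite /upd eqxx.
  by move=> r _ ro; rewrite /upd (negPf ro).
- move=> -> [|r0 [|]] // out fr rho t0 t1 Q _ /= /andP[/andP[r0fr r0out] _] ofr xsE q.
  apply: run_seq; apply: run_copy; [by []|lia|lia|] => r1 h1 h2.
  apply: run_inc; apply: q.
    by rewrite /upd eqxx h1 /thead (tnth_nth 0) -xsE.
  by move=> r rfr ro; rewrite /upd (negPf ro) h2 //; lia.
- move=> -> ins out fr rho t0 t1 Q sz /all_nthP insP ofr xsE q.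
  have ilt : i < size ins by rewrite sz.
  have /andP[rfr ro] := insP 0 i ilt.
  apply: run_copy; [by []|lia|lia|] => r1 h1 h2.
  apply: q; first by rewrite h1 (tnth_nth 0) -xsE (nth_map 0).
  by move=> r rf ro'; rewrite h2 //; lia.
- move=> [zs hzs gzs] ins out fr rho t0 t1 Q sz insP ofr xsE q.
  apply: run_seq.
  have insb : all (fun r => r < fr) ins by apply: sub_all insP => r /andP[].
  pose J rho' (l : seq 'I_m) := (forall r, r < fr -> rho' r = rho r) /\
     (forall i, i \in l -> rho' (fr + i) = tnth zs i).
  (* l' lists the components already computed, l those still to come. *)
  have loop (l l' : seq 'I_m) rho1 (Q' : postcond) : J rho1 l' ->
     (forall rho2, J rho2 (rev l ++ l') -> Q' rho2 t0 t1) ->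
     run (cseqs [seq compile (h i) ins (fr + i) (fr + m) | i <- l]) rho1 t0 t1 Q'.
    elim: l l' rho1 => [|i l IH] l' rho1 [J1 J2] q' /=.
      by apply: run_skip; apply: q'.
    have ilt := ltn_ord i.
    apply: run_seq; apply: (IHh i _ _ (hzs i)) => //.
    - apply: sub_all insb => r rfr /=; lia.
    - lia.
    - rewrite -xsE; apply/eq_in_map => r /(allP insb); exact: J1.
    move=> rho2 h1 h2; apply: (IH (i :: l')) => [|rho3].
      split=> [r rfr|k]; first by rewrite h2 ?J1 //; lia.
      rewrite inE => /orP[/eqP->//|kl].
      have [->//|ki] := eqVneq k i.
      have klt := ltn_ord k.
      rewrite h2 ?J2 //; first by lia.
      by rewrite eqn_add2l.
    by rewrite -cat_rcons -rev_cons; apply: q'.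
  apply: (loop _ [::]); first by [].
  move=> rho1 []; rewrite cats0 => J1 J2.
  apply: (IHg _ _ gzs) => //.
  + by rewrite size_iota.
  + by apply/allP => r; rewrite mem_iota; lia.
  + lia.
  + apply: (@eq_from_nth _ 0); first by rewrite size_map size_iota size_tuple.
    move=> i; rewrite size_map size_iota => im.
    rewrite (nth_map 0) ?size_iota // nth_iota //.
    have := J2 (Ordinal im); rewrite mem_rev mem_enum => -> //.
    by rewrite (tnth_nth 0).
  move=> rho2 h1 h2; apply: q => // r rfr ro.
  by rewrite h2 ?J1 //; lia.
- move=> G [|r0 ins] // out fr rho t0 t1 Q [sz] /= /andP[/andP[r0fr r0out] insP] ofr xsE q.
  have insb : all (fun r => r < fr) ins by apply: sub_all insP => r /andP[].
  have th : thead xs = rho r0 by rewrite /thead (tnth_nth 0) -xsE.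
  have bh : [seq rho r | r <- ins] = behead xs by rewrite -xsE.
  rewrite th in G.
  apply/run_seq/run_copy; [lia|lia|lia|] => r1 c1 c2.
  have frame r' : (forall r, r < fr -> r' r = rho r) ->
    [seq r' r | r <- ins] = behead xs.
    by move=> e; rewrite -bh; apply/eq_in_map => r /(allP insb) /e.
  have c2' r : r < fr -> r1 r = rho r by move=> rfr; rewrite c2 //; lia.
  apply/run_seq.
  have [v Gv] : exists v, rec_graph g [tuple of behead xs] v.
    elim: (rho r0) y G {q} => [y G|k IH y [u /IH //]]; by exists y.
  have fr4 : fr.+2.+2 = fr.+4 by [].
  apply: (IHg _ _ Gv) => //.
  + by apply: sub_all insb => r rfr; lia.
  + by lia.
  + exact: (frame r1 c2').
  move=> r2 d1 d2.
  have d2' r : r < fr -> r2 r = rho r by move=> rfr; rewrite d2 ?c2' //; lia.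
  apply/run_seq/run_clear/run_seq.
  have loop j k u rho1 (Q' : postcond) : 
    primrec_graph (rec_graph g [tuple of behead xs])
      (fun k u => rec_graph h [tuple of k :: u :: [tuple of behead xs]]) k u ->
    primrec_graph (rec_graph g [tuple of behead xs])
      (fun k u => rec_graph h [tuple of k :: u :: [tuple of behead xs]]) (j + k) y ->
    rho1 fr = u -> rho1 fr.+1 = k -> rho1 fr.+2 = j ->
    (forall r, r < fr -> rho1 r = rho r) ->
    (forall rho', rho' fr = y -> (forall r, r < fr -> rho' r = rho r) -> Q' rho' t0 t1) ->
    run (cwhile fr.+2 (TSeq (cdec fr.+2)
             (TSeq (compile h [:: fr.+1, fr & ins] fr.+3 fr.+4)
             (TSeq (ccopy fr.+3 fr fr.+4) (cinc fr.+1))))) rho1 t0 t1 Q'.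
    have Gfun : forall a b, rec_graph g [tuple of behead xs] a ->
      rec_graph g [tuple of behead xs] b -> a = b by move=> a b; apply: rec_graph_fun.
    have Hfun i w a b : rec_graph h [tuple of i :: w :: [tuple of behead xs]] a ->
      rec_graph h [tuple of i :: w :: [tuple of behead xs]] b -> a = b.
      exact: rec_graph_fun.
    elim: j k u rho1 Q' => [|j IH] k u rho1 Q' Gk Gy fu fk fj fr1 q'.
      apply: run_while_end => //; apply: q' => //; rewrite fu.
      exact: primrec_graph_fun Gk Gy.
    apply: run_while_step; first by rewrite fj.
    apply/run_seq/(run_dec fj)/run_seq.
    have [u1 Gk1] : exists u1, primrec_graph (rec_graph g [tuple of behead xs])
      (fun k u => rec_graph h [tuple of k :: u :: [tuple of behead xs]]) k.+1 u1.
      by apply: (@primrec_graph_down _ _ j k.+1 y); rewrite addnS.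
    have [u0 Gu0 Hu1] := Gk1.
    rewrite -(primrec_graph_fun Gfun Hfun Gk Gu0) in Hu1.
    apply: (IHh _ _ Hu1) => //.
    - by rewrite /= sz.
    - rewrite /= !andbA; apply/andP; split; first by lia.
      by apply: sub_all insb => r rfr; lia.
    - rewrite /= /upd !ltn_eqF // fu fk; congr [:: _, _ & _]; rewrite -bh.
      by apply/eq_in_map => r /(allP insb) rfr; rewrite ltn_eqF ?fr1 //; lia.
    move=> r3 e1 e2; apply/run_seq/run_copy; [lia|lia|lia|] => r4 f1 f2.
    have r4E r : r < fr.+3 -> r != fr -> r4 r = upd rho1 fr.+2 j r.
      by move=> rfr rne; rewrite f2 ?e2 //; lia.
    apply/run_inc/(IH k.+1 u1) => //.
    - by rewrite addnS.
    - by rewrite /upd ltn_eqF // f1 e1.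
    - by rewrite /upd eqxx r4E; [rewrite /upd ltn_eqF ?fk|lia|lia].
    - by rewrite /upd gtn_eqF // r4E; [rewrite /upd eqxx|lia|lia].
    - move=> r rfr; have r1lt : r < fr.+1 by lia.
      rewrite /upd ltn_eqF // r4E; [|lia|lia].
      by rewrite /upd ltn_eqF ?fr1 //; lia.
  apply: (loop (rho r0) 0 v) => //.
  + by rewrite addn0.
  + by rewrite /upd ltn_eqF.
  + by rewrite /upd eqxx.
  + by rewrite /upd gtn_eqF // d2 ?c1 //; lia.
  + by move=> r rfr; rewrite /upd ltn_eqF ?d2' //; lia.
  move=> r3 e1 e2; apply: run_copy; [lia|lia|lia|] => r4 f1 f2.
  apply: q; first by rewrite f1.
  by move=> r rfr ro; rewrite f2 ?e2 //; lia.
move=> [g0 gpos] ins out fr rho t0 t1 Q sz insP ofr xsE q.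
have insb : all (fun r => r < fr) ins by apply: sub_all insP => r /andP[].
have call i v rho1 (Q' : postcond) : rec_graph g [tuple of i :: xs] v -> rho1 fr = i ->
    (forall r, r < fr -> rho1 r = rho r) ->
    (forall rho', rho' fr = i -> rho' fr.+1 = v -> (forall r, r < fr -> rho' r = rho r) ->
        Q' rho' t0 t1) ->
    run (compile g (fr :: ins) fr.+1 fr.+2) rho1 t0 t1 Q'.
  move=> gv fi frm q'; apply: (IHg _ _ gv) => //.
  - by rewrite /= sz.
  - by rewrite /=; apply/andP; split; [lia|apply: sub_all insb => r rfr; lia].
  - rewrite /= fi -xsE; congr (_ :: _).
    by apply/eq_in_map => r /(allP insb); apply: frm.
  move=> rho' h1 h2; apply: q' => //; first by rewrite h2 //; lia.
  by move=> r rfr; rewrite h2 ?frm //; lia.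
have val i : i <= y -> exists v, rec_graph g [tuple of i :: xs] v.
  by rewrite leq_eqVlt => /orP[/eqP->|/gpos [v gv]]; eexists; eauto.
apply/run_seq/run_clear/run_seq.
have [v0 gv0] := val 0 isT.
apply: (call 0 v0) => //; first by rewrite /upd eqxx.
  by move=> r rfr; rewrite /upd ltn_eqF.
move=> r1 c1 c2 c3; apply: run_seq.
have loop j i rho1 (Q' : postcond) : j + i = y -> rho1 fr = i ->
    rec_graph g [tuple of i :: xs] (rho1 fr.+1) ->
    (forall r, r < fr -> rho1 r = rho r) ->
    (forall rho', rho' fr = y -> (forall r, r < fr -> rho' r = rho r) ->
        Q' rho' t0 t1) ->
    run (cwhile fr.+1 (TSeq (cinc fr) (compile g (fr :: ins) fr.+1 fr.+2))) rho1 t0 t1 Q'.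
  elim: j i rho1 Q' => [|j IH] i rho1 Q' ji fi gi frm q'.
    rewrite add0n in ji; rewrite ji in gi fi.
    by apply: run_while_end; [exact: rec_graph_fun gi g0|apply: q'].
  have iy : i < y by lia.
  have [v gv] := gpos i iy.
  apply: run_while_step; first by rewrite (rec_graph_fun gi gv).
  have [v1 gv1] := val i.+1 iy.
  apply/run_seq/run_inc/(call i.+1 v1) => //.
  - by rewrite /upd eqxx fi.
  - by move=> r rfr; rewrite /upd ltn_eqF ?frm.
  move=> r2 d1 d2 d3; apply: (IH i.+1) => //; first by rewrite addnS.
  by rewrite d2.
apply: (loop y 0) => //; first by rewrite addn0.
  by rewrite c2.
move=> r2 d1 d2; apply: run_copy; [lia|lia|lia|] => r3 e1 e2.
apply: q; first by rewrite e1.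
by move=> r rfr ro; rewrite e2 ?d2 //; lia.
Qed.
End Counters.

(** * The machine that reads the oracle bit by bit *)

Definition isbit (a : symbol void) : bool := if a is Some (inl _) then true else false.

Definition tmove i d := TAct i (fun a => (a, d)).
Definition goright := TWhile 1 isbit (tmove 1 MoveRight).
Definition goleft := TWhile 1 isbit (tmove 1 MoveLeft).
(** Restores the query tape to its initial position, from a head on the last written bit. *)
Definition rewind := TSeq goleft (tmove 1 MoveRight).
Definition put b := TAct 1 (fun=> (Some (inl b), Stay)).
Definition push b := TSeq goright (TSeq (put b) rewind).
Definition replace_last b := TSeq goright (TSeq (tmove 1 MoveLeft) (TSeq (put b) rewind)).
(** Register 1 receives the binary numeral of the input preceded by a 1, and register 0 its
    length. *)
Definition read_input := TWhile 0 isbit (TSeq (cdouble 1 3)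
  (TSeq (TIf 0 isone (cinc 1) TSkip) (TSeq (cinc 0) (tmove 0 MoveRight)))).
Definition cincs r k := cseqs (nseq k (cinc r)).
(** Register 0 counts the bits that remain to be found.  The next bit is guessed to be 1;
    a negative answer corrects it to 0.  Register 2 accumulates the numeral of the prefix. *)
Definition read_oracle := cwhile 0 (TSeq (cdec 0) (TSeq (push true)
  (TSeq (cdouble 2 3) (TQuery (cinc 2) (replace_last false))))).

Definition qtape s := stream_tape ([::], bits s).

Lemma sact_keep d t : sact (fun a => (a, d)) t = smove d t.
Proof. by rewrite /sact swrite_read. Qed.

Section Runs.
Variables (B : set (seq bool)) (L : nat).
Implicit Types (rho : nat -> nat) (Q : postcond).
Local Notation run := (run B L).

Lemma run_act0 d rho t0 t1 Q : Q rho (sact d t0) t1 -> run (TAct 0 d) rho t0 t1 Q.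
Proof.
move=> q st cs e0 e1; exists (supd st 0 (sact d (st 0))), rho; split => //.
  exact: XAct.
by rewrite /supd /= e0 e1.
Qed.

Lemma run_act1 d rho t0 t1 Q : Q rho t0 (sact d t1) -> run (TAct 1 d) rho t0 t1 Q.
Proof.
move=> q st cs e0 e1; exists (supd st 1 (sact d (st 1))), rho; split => //.
  exact: XAct.
by rewrite /supd /= e0 e1.
Qed.

Definition tape01 i (t0 t1 : stape) : stape := if i == 0 then t0 else t1.

Lemma tape01E st i t0 t1 : i < 2 -> st 0 = t0 -> st 1 = t1 ->
  sread st i = (tape01 i t0 t1).2 0.
Proof. by case: i => [|[|]] // _ <- <-. Qed.

Lemma run_twhile_end i P c rho t0 t1 Q : i < 2 -> P ((tape01 i t0 t1).2 0) = false ->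
  Q rho t0 t1 -> run (TWhile i P c) rho t0 t1 Q.
Proof.
move=> i2 Pf q st cs e0 e1; exists st, rho; rewrite e0 e1; split => //.
by apply: XWhileF; rewrite (tape01E i2 e0 e1).
Qed.

Lemma run_twhile_step i (P : symbol void -> bool) c rho t0 t1 Q :
  i < 2 -> P ((tape01 i t0 t1).2 0) ->
  run c rho t0 t1 (fun r u v => run (TWhile i P c) r u v Q) ->
  run (TWhile i P c) rho t0 t1 Q.
Proof.
move=> i2 Pt h st cs e0 e1; have [st1 [r1 [ex1 c1 q]]] := h st cs e0 e1.
have [st2 [r2 [ex2 c2 q2]]] := q st1 c1 erefl erefl.
exists st2, r2; split=> //; apply: XWhileT ex1 ex2.
by rewrite (tape01E i2 e0 e1).
Qed.

Lemma run_tif i P c1 c2 rho t0 t1 Q : i < 2 ->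
  run (if P ((tape01 i t0 t1).2 0) then c1 else c2) rho t0 t1 Q ->
  run (TIf i P c1 c2) rho t0 t1 Q.
Proof.
move=> i2 h st cs e0 e1; have [st1 [r1 [ex1 cs1 q]]] := h st cs e0 e1.
exists st1, r1; split=> //; apply: XIf.
by rewrite (tape01E i2 e0 e1).
Qed.

Lemma run_query s c1 c2 rho t0 Q : size s <= L ->
  run (if `[< B s >] then c1 else c2) rho t0 (qtape s) Q ->
  run (TQuery c1 c2) rho t0 (qtape s) Q.
Proof.
move=> sL h st cs e0 e1; have [st1 [r1 [ex1 cs1 q]]] := h st cs e0 e1.
by exists st1, r1; split=> //; apply: XQuery e1 sL ex1.
Qed.

Lemma run_goright l s rho t0 Q : Q rho t0 (stream_tape (rev (bits s) ++ l, [::])) ->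
  run goright rho t0 (stream_tape (l, bits s)) Q.
Proof.
elim: s l => [|b s IH] l q; first exact: run_twhile_end.
apply: run_twhile_step => //; apply: run_act1.
rewrite sact_keep -stream_tape_move /=; apply: IH.
by move: q; rewrite /= rev_cons cat_rcons.
Qed.

Lemma run_goleft u b r rho t0 Q :
  Q rho t0 (stream_tape ([::], None :: rev (bits u) ++ Some (inl b) :: r)) ->
  run goleft rho t0 (stream_tape (bits u, Some (inl b) :: r)) Q.
Proof.
elim: u b r => [|c u IH] b r q; apply: run_twhile_step => //; apply: run_act1;
  rewrite sact_keep -stream_tape_move /=.
  exact: run_twhile_end.
by apply: IH; move: q; rewrite /= rev_cons cat_rcons.
Qed.

Lemma run_rewind s b rho t0 Q : Q rho t0 (qtape (rcons s b)) ->
  run rewind rho t0 (stream_tape (rev (bits s), [:: Some (inl b)])) Q.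
Proof.
move=> q; apply: run_seq; rewrite -map_rev; apply/run_goleft/run_act1.
rewrite sact_keep -stream_tape_move /= -map_rev revK.
suff -> : stream_tape ([:: None], bits s ++ [:: Some (inl b)]) = qtape (rcons s b) by [].
rewrite /qtape /bits map_rcons cats1; congr pair.
by apply/funext => -[|i]; rewrite /= ?nth_nil.
Qed.

Lemma sact_put b l r :
  sact (fun=> (Some (inl b), Stay)) (stream_tape (l, r)) =
  stream_tape (l, Some (inl b) :: behead r).
Proof. by rewrite /sact /= -(stream_tape_write _ (l, r)). Qed.

Lemma run_push b s rho t0 Q : Q rho t0 (qtape (rcons s b)) ->
  run (push b) rho t0 (qtape s) Q.
Proof.
move=> q; apply/run_seq/run_goright/run_seq/run_act1; rewrite sact_put cats0.
exact: run_rewind.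
Qed.

Lemma run_replace_last b c s rho t0 Q : Q rho t0 (qtape (rcons s b)) ->
  run (replace_last b) rho t0 (qtape (rcons s c)) Q.
Proof.
move=> q; apply/run_seq/run_goright/run_seq/run_act1.
rewrite sact_keep -stream_tape_move /= cats0 /bits map_rcons rev_rcons /=.
apply/run_seq/run_act1; rewrite sact_put.
exact: run_rewind.
Qed.

Lemma run_cincs r k rho t0 t1 Q :
  (forall rho', rho' r = rho r + k -> (forall i, i != r -> rho' i = rho i) ->
     Q rho' t0 t1) ->
  run (cincs r k) rho t0 t1 Q.
Proof.
elim: k rho => [|k IH] rho q; first by apply: run_skip; apply: q; rewrite ?addn0.
apply/run_seq/run_inc/IH => rho' h1 h2; apply: q.
  by rewrite h1 /upd eqxx addSnnS.
by move=> i ir; rewrite h2 // /upd (negPf ir).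
Qed.

Lemma run_read_input l x rho t1 Q :
  (forall rho' u, rho' 1 = foldl (fun v (b : bool) => v.*2 + b) (rho 1) x ->
     rho' 0 = rho 0 + size x -> rho' 2 = rho 2 -> Q rho' u t1) ->
  run read_input rho (stream_tape (l, bits x)) t1 Q.
Proof.
elim: x l rho => [|b x IH] l rho q.
  by apply: run_twhile_end => //; apply: q; rewrite ?addn0.
apply: run_twhile_step => //; apply/run_seq/run_double => // r1 h1 h2.
apply/run_seq/run_tif => //.
have last r2 : r2 1 = (rho 1).*2 + b -> (forall i, i != 1 -> r2 i = r1 i) ->
  run (TSeq (cinc 0) (tmove 0 MoveRight)) r2 (stream_tape (l, bits (b :: x))) t1
  (fun rho u v => run read_input rho u v Q).
  move=> k1 k2; apply/run_seq/run_inc/run_act0.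
  rewrite sact_keep -stream_tape_move; apply: IH => r3 u e1 e2 e3; apply: q.
  - by rewrite e1 /upd /= k1.
  - by rewrite e2 /upd /= k2 // h2 // addSnnS.
  - by rewrite e3 /upd /= k2 // h2.
rewrite /tape01 /=; case: b {q} last => last.
  apply: run_inc; apply: last => [|i i1]; first by rewrite /upd eqxx h1 addn1.
  by rewrite /upd (negPf i1).
by apply: run_skip; apply: last => //; rewrite h1 addn0.
Qed.

Lemma run_read_oracle (b : nat -> bool) j n rho t0 Q :
  (forall n, B (rcons (mkseq b n) true) <-> b n) ->
  rho 0 = j -> n + j <= L -> rho 2 = numeral (mkseq b n) ->
  (forall rho' v, rho' 2 = numeral (mkseq b (n + j)) -> rho' 1 = rho 1 ->
     Q rho' t0 v) ->
  run read_oracle rho t0 (qtape (mkseq b n)) Q.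
Proof.
move=> Bb; elim: j n rho => [|j IH] n rho r0 nj r2 q.
  by apply: run_while_end => //; apply: q; rewrite ?addn0.
apply: run_while_step; first by rewrite r0.
apply/run_seq/(run_dec _ _ r0)/run_seq/run_push/run_seq/run_double => // r1 h1 h2.
apply: run_query; first by rewrite size_rcons size_mkseq; lia.
have r12 : r1 2 = (numeral (mkseq b n)).*2 by rewrite h1 /upd /= r2.
have -> : `[< B (rcons (mkseq b n) true) >] = b n.
  by apply/idP/idP => [/asboolP/Bb|/Bb/asboolP].
have next r3 : r3 2 = (numeral (mkseq b n)).*2 + b n -> r3 0 = j -> r3 1 = rho 1 ->
   run read_oracle r3 t0 (qtape (rcons (mkseq b n) (b n))) Q.
  move=> k1 k2 k3; rewrite -mkseqS; apply: IH => //; first by rewrite addSnnS.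
    by rewrite mkseqS numeral_rcons.
  by move=> r4 v e1 e2; apply: q; rewrite ?e2 // e1 addSnnS.
case: (b n) next => next.
  by apply: run_inc; apply: next; rewrite /upd /= ?r12 ?addn1 // h2.
by apply: run_replace_last; apply: next; rewrite ?r12 ?addn0 ?h2 //.
Qed.

End Runs.

(** The two final decrements turn numerals with a leading 1 into string codes. *)
Definition oracle_program (e : recfun 2) k :=
  TSeq (cinc 1) (TSeq (cinc 2) (TSeq read_input (TSeq (cincs 0 k) (TSeq read_oracle
  (TSeq (cdec 1) (TSeq (cdec 2) (compile e [:: 1; 2] 3 4))))))).

(** A decision procedure that is recursive in x and in the prefix of b of length |x| + k can
    be carried out by a machine whose oracle merely recognizes the prefixes of b. *)
Lemma oracle_machine (e : recfun 2) (A B : set (seq bool)) (b : nat -> bool) k :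
  (forall n, B (rcons (mkseq b n) true) <-> b n) ->
  (forall x, rec_graph e [tuple string_code x; string_code (mkseq b (size x + k))]
     (`[< A x >] : bool)) ->
  exists M, reduces_via M A B /\
    forall x s, queries M B x s -> size s <= size x + k.
Proof.
move=> Bb eA.
apply: (@machine_of_cmd (oracle_program e k) 5 isone) => x.
have cs0 : counters (init_store x) (fun=> 0) by move=> r; split.
suff : run B (size x + k) (oracle_program e k) (fun=> 0)
    (stream_tape ([::], bits x)) (qtape [::]) (fun rho _ _ => rho 3 = `[< A x >]).
  move=> /(_ _ cs0 erefl erefl) [st [rho [ex cs r3]]]; exists st => //.
  by rewrite (counter_read 3 cs) r3; case: `[< _ >].
apply/run_seq/run_inc/run_seq/run_inc/run_seq/run_read_input => r1 u h1 h2 h3.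
apply/run_seq/run_cincs => r2 k1 k2; apply: run_seq.
apply: (@run_read_oracle _ _ b (size x + k) 0) => //.
  by rewrite k1 h2.
  by rewrite k2 // h3.
move=> r3 v l1 l2.
have r32 : r3 2 = (string_code (mkseq b (size x + k))).+1 by rewrite l1 string_codeE.
have r31 : r3 1 = (string_code x).+1 by rewrite l2 k2 // h1 string_codeE.
apply/run_seq/(run_dec _ _ r31)/run_seq.
apply: (@run_dec _ _ 2 _ _ _ (string_code (mkseq b (size x + k)))); first by rewrite /upd.
by apply: (compileP _ _ (eA x)).
Qed.

(** * Kraft's inequality and the finiteness of Omega *)

Definition strip (b : bool) (p : seq bool) : option (seq bool) :=
  if p is c :: p' then if c == b then Some p' else None else None.

Lemma stripK b : ocancel (strip b) (cons b).
Proof. by case=> //= c p; case: eqP => //= ->. Qed.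

Lemma mem_strip b (s : seq (seq bool)) p : (p \in pmap (strip b) s) = (b :: p \in s).
Proof.
rewrite mem_pmap; apply/mapP/idP => [[[|c q] qs] //=|ps].
  by case: eqP => // cb [->]; rewrite -cb.
by exists (b :: p); rewrite //= eqxx.
Qed.

(** Scaled by 2^N to stay within the natural numbers.  The strings starting with 1 and
    those starting with 0, without their first bit, satisfy the hypotheses for N - 1,
    unless the empty string is present, and then it is alone. *)
Lemma kraft_nat N (s : seq (seq bool)) : uniq s ->
  (forall p q, p \in s -> q \in s -> prefix p q -> p = q) ->
  (forall p, p \in s -> size p <= N) ->
  \sum_(p <- s) 2 ^ (N - size p) <= 2 ^ N.
Proof.
elim: N s => [|N IH] s us pf sN.
  have [|nil0] := boolP ([::] \in s); last first.
    suff -> : s = [::] by rewrite big_nil.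
    case: s {us pf} sN nil0 => // p s /(_ p); rewrite !inE eqxx => /(_ isT).
    by rewrite leqn0 size_eq0 => /eqP ->.
  move=> n0; suff -> : s = [:: [::]] by rewrite big_seq1.
  apply: perm_small_eq => //; apply: uniq_perm => // p; rewrite inE.
  apply/idP/eqP => [ps|->//].
  by apply/esym; apply: pf => //; rewrite prefix0s.
have [n0|nil0] := boolP ([::] \in s).
  have -> : s = [:: [::]].
    apply: perm_small_eq => //; apply: uniq_perm => // p; rewrite inE.
    apply/idP/eqP => [ps|->//].
    by apply/esym; apply: pf => //; rewrite prefix0s.
  by rewrite big_seq1 subn0.
have -> : \sum_(p <- s) 2 ^ (N.+1 - size p) =
   \sum_(p <- pmap (strip true) s) 2 ^ (N - size p) +
   \sum_(p <- pmap (strip false) s) 2 ^ (N - size p).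
  elim: s nil0 {us pf sN} => [|[|c p] s IHs]; rewrite ?big_nil ?inE //.
  rewrite big_cons => /IHs -> /=; case: c => /=; rewrite big_cons subSS; lia.
have half b : \sum_(p <- pmap (strip b) s) 2 ^ (N - size p) <= 2 ^ N.
  apply: IH; first exact: (pmap_uniq (@stripK b) us).
    move=> p q; rewrite !mem_strip => ps qs pq.
    by have := pf _ _ ps qs; rewrite /= eqxx => /(_ pq) [].
  by move=> p; rewrite mem_strip => /sN.
rewrite expnS mul2n -addnn; exact: leq_add.
Qed.

Section Omega.
Variable R : realType.
Local Open Scope ring_scope.

Definition weight (p : seq bool) : R := 2^-1 ^+ size p.

Lemma weight_ge0 p : 0 <= weight p.
Proof. by rewrite exprn_ge0 // invr_ge0. Qed.

Lemma weightE N p : (size p <= N)%N -> weight p = (2 ^ (N - size p))%:R / 2 ^+ N.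
Proof.
move=> pN; rewrite natrX /weight exprVn -[in 2 ^+ N](subnK pN) exprD.
by field; rewrite !expf_neq0 //=; lra.
Qed.

Lemma sum_weightE N (s : seq (seq bool)) : (forall p, p \in s -> size p <= N)%N ->
  \sum_(p <- s) weight p = (\sum_(p <- s) 2 ^ (N - size p))%:R / 2 ^+ N.
Proof.
move=> sN; rewrite natr_sum mulr_suml big_seq [RHS]big_seq.
by apply: eq_bigr => p /sN; apply: weightE.
Qed.

Lemma kraft (s : seq (seq bool)) : uniq s ->
  (forall p q, p \in s -> q \in s -> prefix p q -> p = q) ->
  \sum_(p <- s) weight p <= 1.
Proof.
move=> us pf; pose N := (\max_(p <- s) size p)%N.
have sN p : p \in s -> (size p <= N)%N.
  by move=> ps; rewrite /N (bigD1_seq p) //= leq_maxl.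
rewrite (sum_weightE sN) ler_pdivrMr ?exprn_gt0 // mul1r -natrX ler_nat.
exact: kraft_nat.
Qed.

Variable V : seq bool -> option (seq bool).
Hypothesis pfV : prefix_free (dom V).

Local Notation wsum := (\esum_(p in dom V) (weight p)%:E).

Lemma esum_seq (s : seq (seq bool)) : uniq s -> (forall p, p \in s -> dom V p) ->
  ((\sum_(p <- s) weight p)%:E <= wsum)%E.
Proof.
move=> us sV; apply: ereal_sup_ubound; exists [set` s]%classic.
  by split; [exact: finite_seq|move=> p /= /sV].
by rewrite -fsbig_seq // -sumEFin.
Qed.

(** Finiteness is what makes [Omega], a [fine] part, the actual sum. *)
Lemma esum_weight_fin : wsum \is a fin_num.
Proof.
rewrite ge0_fin_numE; last by apply: esum_ge0 => p _; rewrite lee_fin weight_ge0.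
apply: (@le_lt_trans _ _ 1%:E); last exact: ltry.
apply: ge_ereal_sup => _ [A [finA AV] <-].
rewrite fsbig_finite // sumEFin lee_fin; apply: kraft; first exact: fset_uniq.
by move=> p q; rewrite !in_fset_set // => /set_mem/AV pV /set_mem/AV qV; apply: pfV.
Qed.

Lemma Omega_fin : (Omega R V)%:E = wsum.
Proof. by rewrite /Omega fineK // esum_weight_fin. Qed.

Lemma sum_le_Omega (s : seq (seq bool)) : uniq s -> (forall p, p \in s -> dom V p) ->
  \sum_(p <- s) weight p <= Omega R V.
Proof. by move=> us sV; rewrite -lee_fin Omega_fin; apply: esum_seq. Qed.

Lemma Omega_ge0 : 0 <= Omega R V.
Proof. by have := @sum_le_Omega [::] isT; rewrite big_nil; apply. Qed.

Lemma Omega_adherent eps : 0 < eps -> exists s : seq (seq bool),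
  [/\ uniq s, forall p, p \in s -> dom V p & Omega R V - eps < \sum_(p <- s) weight p].
Proof.
move=> e0; have [_ [A [finA AV] <-]] := ub_ereal_sup_adherent e0 esum_weight_fin.
rewrite -/(esum _ _) -Omega_fin fsbig_finite // sumEFin -EFinB lte_fin => lt.
exists (fset_set A); split=> //; first exact: fset_uniq.
by move=> p; rewrite in_fset_set // => /set_mem/AV.
Qed.

End Omega.

(** * Base-two expansions *)

Section Expansion.
Variable R : realType.
Local Open Scope ring_scope.

Lemma half_pow_small (e : R) : 0 < e ->
  exists k, forall n, (k <= n)%N -> 2^-1 ^+ n < e.
Proof.
move=> e0; exists (Num.truncn e^-1) => n kn.
have /truncn_itv/andP[_ lt] : 0 <= e^-1 by rewrite invr_ge0 ltW.
rewrite exprVn invf_plt ?posrE ?exprn_gt0 //; apply: lt_le_trans lt _.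
by rewrite -natrX ler_nat; apply: leq_ltn_trans kn (ltn_expl _ _).
Qed.

(** The partial sum of the binary series; subtracting 1 removes the leading 1 of the
    numeral. *)
Definition binary_sum (b : nat -> bool) n : R := (numeral (mkseq b n))%:R / 2 ^+ n - 1.

Lemma binary_sumS (b : nat -> bool) n :
  binary_sum b n.+1 = binary_sum b n + (b n)%:R / 2 ^+ n.+1.
Proof.
rewrite /binary_sum mkseqS numeral_rcons natrD -muln2 natrM exprS.
by field; rewrite expf_neq0 //; lra.
Qed.

Lemma series_binary_sum (b : nat -> bool) n :
  series (fun i => (b i)%:R / 2 ^+ i.+1 : R) n = binary_sum b n.
Proof.
elim: n => [|n IH]; last by rewrite seriesSr IH binary_sumS.
by rewrite /series /= big_nil /binary_sum /numeral /= expr0 divr1 subrr.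
Qed.

Lemma binary_sum_mono b n m : (n <= m)%N -> binary_sum b n <= binary_sum b m.
Proof.
move=> /subnK <-; elim: (m - n)%N => // k IH; rewrite addSn binary_sumS.
by rewrite (le_trans IH) // lerDl divr_ge0 // exprn_ge0.
Qed.

Lemma binary_sum_anti b n m : (n <= m)%N ->
  binary_sum b m + 2^-1 ^+ m <= binary_sum b n + 2^-1 ^+ n.
Proof.
move=> /subnK <-; elim: (m - n)%N => // k IH; rewrite addSn binary_sumS.
rewrite (le_trans _ IH) // -addrA lerD2l.
set j := (k + n)%N; rewrite -exprVn exprS.
have : 0 <= 2^-1 ^+ j :> R by rewrite exprn_ge0 // invr_ge0.
by case: (b j) => /=; lra.
Qed.

(** The strict upper bound comes from a later zero: at that place the upper sums, which
    decrease towards the limit, drop strictly. *)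
Lemma base_two_expansionP (alpha : R) b : base_two_expansion alpha b ->
  forall n, binary_sum b n <= alpha - (Num.floor alpha)%:~R < binary_sum b n + 2^-1 ^+ n.
Proof.
move=> [zeros cv] n; set beta := alpha - _ in cv *.
have cvb : (binary_sum b @ \oo --> beta)%classic.
  by rewrite -[binary_sum b](_ : series (fun i => (b i)%:R / 2 ^+ i.+1 : R) = _) //;
    apply/funext => i; rewrite series_binary_sum.
have le1 k : binary_sum b k <= beta.
  rewrite -(cvg_lim _ cvb) //; apply: limr_ge; first by apply/cvg_ex; exists beta.
  by exists k => // i /= ki; apply: binary_sum_mono.
have le2 k : beta <= binary_sum b k + 2^-1 ^+ k.
  rewrite -(cvg_lim _ cvb) //; apply: limr_le; first by apply/cvg_ex; exists beta.
  exists k => // i /= ki; apply: le_trans (binary_sum_anti b ki).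
  by rewrite lerDl exprn_ge0 // invr_ge0.
rewrite le1 /=.
have [i ni bi] := zeros n.
apply: lt_le_trans (binary_sum_anti b ni).
apply: le_lt_trans (le2 i.+1) _; rewrite binary_sumS bi mul0r addr0 ltrD2l exprS.
have : 0 < 2^-1 ^+ i :> R by rewrite exprn_gt0 // invr_gt0.
by lra.
Qed.

(** The prefixes of an expansion are the integer parts of the scaled number, hence
    the expansion is unique. *)
Lemma base_two_numeral (alpha : R) b n : base_two_expansion alpha b ->
  Num.truncn ((alpha - (Num.floor alpha)%:~R + 1) * 2 ^+ n) = numeral (mkseq b n).
Proof.
move=> /base_two_expansionP /(_ n); rewrite /binary_sum => /andP[lo hi].
have p0 : 0 < 2 ^+ n :> R by rewrite exprn_gt0.
apply: truncn_def; rewrite -ler_pdivrMr // -ltr_pdivlMr //.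
apply/andP; split; first by lra.
apply: lt_le_trans (_ : _ < (numeral (mkseq b n))%:R / 2 ^+ n + 2^-1 ^+ n) _; first by lra.
by rewrite exprVn -[X in _ + X]mul1r -mulrDl natr1.
Qed.

Lemma base_two_unique (alpha : R) b b' :
  base_two_expansion alpha b -> base_two_expansion alpha b' -> b =1 b'.
Proof.
move=> eb eb' n.
have := base_two_numeral n.+1 eb; rewrite (base_two_numeral n.+1 eb') !mkseqS !numeral_rcons.
have := base_two_numeral n eb; rewrite (base_two_numeral n eb') => ->.
by move/addnI; case: (b n); case: (b' n).
Qed.

(** The bits are the parities of the integer parts of 2^(n+1) times the fractional part.
    If they were all ones from place m on, the fractional part would equal its upper
    bound at m, against the strictness of that bound. *)
Lemma base_two_exists (alpha : R) : exists b, base_two_expansion alpha b.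
Proof.
set beta := alpha - (Num.floor alpha)%:~R.
have beta0 : 0 <= beta by rewrite subr_ge0 ge_floor.
have beta1 : beta < 1.
  by have := lt_succ_floor alpha; rewrite rmorphD /= /beta; lra.
pose N n := Num.truncn ((beta + 1) * 2 ^+ n).
have Nitv n : (N n)%:R / 2 ^+ n <= beta + 1 < (N n)%:R / 2 ^+ n + 2^-1 ^+ n.
  have p0 : 0 < 2 ^+ n :> R by rewrite exprn_gt0.
  have /truncn_itv : 0 <= (beta + 1) * 2 ^+ n by rewrite mulr_ge0 ?exprn_ge0 //; lra.
  rewrite -/(N n) -ler_pdivrMr // -ltr_pdivlMr // => /andP[-> /=].
  by rewrite -addn1 natrD mulrDl mul1r -exprVn.
pose b n := odd (N n.+1).
have N0 : N 0%N = 1%N.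
  by apply: truncn_def; rewrite expr0; lra.
have NS n : N n.+1 = ((N n).*2 + b n)%N.
  have p0 : 0 < 2 ^+ n :> R by rewrite exprn_gt0.
  suff : (N n.+1)./2 = N n by move=> <-; rewrite addnC odd_double_half.
  apply/esym/truncn_def; have := Nitv n.+1.
  set h := (N n.+1)./2; set o := odd (N n.+1).
  have -> : (N n.+1)%:R = o%:R + h%:R * 2 :> R.
    by rewrite -[in LHS](odd_double_half (N n.+1)) natrD -muln2 natrM.
  have -> : (o%:R + h%:R * 2) / 2 ^+ n.+1 =
      h%:R / 2 ^+ n + o%:R * (2^-1 * (2 ^+ n)^-1) :> R.
    by rewrite exprS; field; rewrite expf_neq0 //; lra.
  rewrite exprVn exprS invfM -ler_pdivrMr // -ltr_pdivlMr // -[h.+1%:R]natr1 mulrDl mul1r.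
  have : 0 < (2 ^+ n)^-1 :> R by rewrite invr_gt0.
  by case: (o) => /=; lra.
have NE n : N n = numeral (mkseq b n).
  by elim: n => [|n IH]; rewrite ?N0 // NS IH mkseqS numeral_rcons.
have bs n : binary_sum b n <= beta < binary_sum b n + 2^-1 ^+ n.
  by have := Nitv n; rewrite NE /binary_sum; lra.
exists b; split.
  move=> m; apply: contrapT => no.
  have ones i : (m <= i)%N -> b i.
    by move=> mi; apply/negPn/negP => /negbTE bi; apply: no; exists i.
  have const k : binary_sum b (k + m) + 2^-1 ^+ (k + m) = binary_sum b m + 2^-1 ^+ m.
    elim: k => // k <-; rewrite addSn binary_sumS ones ?leq_addl // -exprVn exprS.
    by rewrite /=; lra.
  have /andP[_] := bs m; rewrite -subr_gt0 => gap.
  have [k] : exists k, 2^-1 ^+ k < binary_sum b m + 2^-1 ^+ m - beta.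
    by have [k kP] := half_pow_small gap; exists k; apply: kP.
  have := bs (k + m)%N; have := const k.
  have : 2^-1 ^+ (k + m) <= 2^-1 ^+ k :> R.
    by rewrite exprD ler_piMr ?exprn_ge0 ?invr_ge0 ?exprn_ile1 //; lra.
  by lra.
rewrite -/beta (_ : series _ = binary_sum b); last first.
  by apply/funext => i; rewrite series_binary_sum.
apply/cvgrPdist_lt => e e0; have [k kP] := half_pow_small e0.
exists k => // i /= ki; have /andP[lo hi] := bs i.
by rewrite ger0_norm ?subr_ge0 //; have := kP i ki; lra.
Qed.

End Expansion.

(** * Halting stages of a machine *)

Definition halted (e : recfun 1) s q : bool := isSome (eval_upto e s [:: q]).

Lemma halted_mono e s s' q : s <= s' -> halted e s q -> halted e s' q.
Proof.
rewrite /halted => ss'; case E: (eval_upto e s _) => [y|] // _.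
by rewrite (eval_upto_mono ss' E).
Qed.

Lemma c_halted (A : encType) e (s q : A -> nat) : computable s -> computable q ->
  computable (fun a => halted e (s a) (q a)).
Proof.
move=> cs cq.
exact: (c_ocase (g := fun _ _ => true)
  (c_app2 (f := eval_upto e) (c_eval_upto e) cs (c_cons cq (c_cst [::])))
  (c_cst false) (c_cst true)).
Qed.

Definition computes (e : recfun 1) (F : seq bool -> option (seq bool)) :=
  forall p y, F p = Some y <-> rec_graph e [tuple string_code p] (string_code y).

Lemma computes_eval_upto e F : computes e F -> forall s p y,
  eval_upto e s [:: string_code p] = Some y -> F p = Some (string_decode y).
Proof.
by move=> eF s p y E; apply/eF; rewrite string_decodeK; apply/eval_uptoP; exists s.
Qed.

Lemma computes_halted e F : computes e F -> forall p,
  dom F p <-> exists s, halted e s (string_code p).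
Proof.
move=> eF p; split; rewrite /dom /=.
  case E: (F p) => [y|] // _; move/eF/eval_uptoP: E => [s E].
  by exists s; rewrite /halted /= E.
move=> [s]; rewrite /halted; case E: (eval_upto e s _) => [y|] // _.
by rewrite (computes_eval_upto eF E).
Qed.

(** * Approximating Omega from below *)

Definition halted_by e s : seq (seq bool) :=
  [seq string_decode q | q <- iota 0 s & halted e s q].

(** The weight of the programs that have halted by stage s, scaled by 2^s.  All of them are
    shorter than s, so this is an integer. *)
Definition stage_weight e s :=
  sumn [seq if halted e s q then 2 ^ (s - size (string_decode q)) else 0 | q <- iota 0 s].

Lemma mem_halted_by e s p :
  (p \in halted_by e s) = (string_code p < s) && halted e s (string_code p).
Proof.
apply/mapP/andP => [[q]|[ps hp]].
  by rewrite mem_filter mem_iota => /andP[hq /andP[_ qs]] ->; rewrite string_decodeK.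
by exists (string_code p); rewrite ?string_codeK // mem_filter mem_iota hp.
Qed.

Lemma halted_by_uniq e s : uniq (halted_by e s).
Proof.
by rewrite map_inj_uniq ?filter_uniq ?iota_uniq //; apply: can_inj string_decodeK.
Qed.

Lemma stage_weightE (R : realType) e s :
  (\sum_(p <- halted_by e s) weight R p = (stage_weight e s)%:R / 2 ^+ s)%R.
Proof.
rewrite (@sum_weightE _ s); last first.
  by move=> p; rewrite mem_halted_by => /andP[/string_code_lt/ltnW].
by rewrite /stage_weight sumnE !big_map big_filter -big_mkcond.
Qed.

(** The integer form of the comparison in [stage_okE]: the weight found by stage s, plus
    2^-m, reaches the truncation of Omega given by its integer part z and by the string
    coded by u. *)
Definition stage_ok e z m u s :=
  u.+1 * 2 ^ s + z * (2 ^ m * 2 ^ s) <= stage_weight e s * 2 ^ m + 2 ^ s + 2 ^ m * 2 ^ s.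

Lemma stage_okE (R : realType) e z (b : nat -> bool) m s :
  stage_ok e z m (string_code (mkseq b m)) s =
  (binary_sum R b m + z%:R <= (stage_weight e s)%:R / 2 ^+ s + 2^-1 ^+ m)%R.
Proof.
rewrite /stage_ok string_codeE /binary_sum.
set N := numeral _; set A := stage_weight _ _.
rewrite -(ler_nat R) !natrD !natrM !natrX.
have m0 : (0 < 2 ^+ m :> R)%R by rewrite exprn_gt0.
have s0 : (0 < 2 ^+ s :> R)%R by rewrite exprn_gt0.
rewrite exprVn; set x := (2 ^+ m)%R in m0 *; set y := (2 ^+ s)%R in s0 *.
rewrite -[RHS](ler_pM2r (mulr_gt0 m0 s0)).
have -> : ((N%:R / x - 1 + z%:R) * (x * y) = N%:R * y + z%:R * (x * y) - x * y)%R.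
  by field; rewrite gt_eqF.
have -> : ((A%:R / y + x^-1) * (x * y) = A%:R * x + y)%R.
  by field; rewrite !gt_eqF.
by rewrite lerBlDr.
Qed.

Section Stages.
Variables (R : realType) (V : seq bool -> option (seq bool)) (e : recfun 1).
Hypotheses (pfV : prefix_free (dom V)) (eV : computes e V).
Variables (b : nat -> bool) (z : nat).
Hypotheses (bO : base_two_expansion (Omega R V) b)
  (zE : ((Num.floor (Omega R V))%:~R = z%:R :> R)%R).

Lemma halted_by_dom s p : p \in halted_by e s -> dom V p.
Proof.
by rewrite mem_halted_by => /andP[_ hp]; apply/(computes_halted eV); exists s.
Qed.

(** The truncation does not exceed Omega, and the weights found by the stages come
    within 2^-m of Omega. *)
Lemma stage_exists m : exists s, stage_ok e z m (string_code (mkseq b m)) s.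
Proof.
have e0 : (0 < 2^-1 ^+ m :> R)%R by rewrite exprn_gt0 ?invr_gt0.
have [l [ul lV lt]] := Omega_adherent pfV e0.
have [s ls] : exists s, forall p, p \in l -> p \in halted_by e s.
  elim: l lV {ul lt} => [|p l IH] lV; first by exists 0.
  have [q ql|s sP] := IH; first by apply: lV; rewrite inE ql orbT.
  have /(computes_halted eV) [t tP] := lV p (mem_head _ _).
  exists (maxn (maxn s t) (string_code p).+1) => q; rewrite inE mem_halted_by.
  case/orP => [/eqP ->|/sP]; first by rewrite leq_maxr; apply: halted_mono tP; lia.
  rewrite mem_halted_by => /andP[qs hq]; apply/andP; split; first by lia.
  by apply: halted_mono hq; lia.
exists s; rewrite (stage_okE R) -stage_weightE.
have /andP[bs _] := base_two_expansionP bO m; rewrite zE in bs.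
have : (\sum_(p <- l) weight R p <= \sum_(p <- halted_by e s) weight R p)%R.
  have pm : perm_eq l [seq p <- halted_by e s | p \in l].
    apply: uniq_perm => //; first by rewrite filter_uniq ?halted_by_uniq.
    by move=> p; rewrite mem_filter; case pl: (p \in l) => //=; rewrite ls.
  rewrite (perm_big _ pm) big_filter big_mkcond /=; apply: ler_sum => p _.
  by case: ifP => // _; apply: weight_ge0.
by lra.
Qed.

(** Otherwise the weight 2^-|p| >= 2 * 2^-m could be added to that of the programs found by
    stage s without exceeding Omega, which is less than the truncation plus 2^-m. *)
Lemma stage_complete m s : stage_ok e z m (string_code (mkseq b m)) s ->
  forall p, dom V p -> size p < m -> p \in halted_by e s.
Proof.
rewrite (stage_okE R) -stage_weightE => ok p pV pm.
apply/negPn/negP => pn.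
have := @sum_le_Omega R V pfV (p :: halted_by e s); rewrite /= pn halted_by_uniq big_cons.
have pl q : q \in p :: halted_by e s -> dom V q.
  by rewrite inE => /orP[/eqP->//|/halted_by_dom].
move=> /(_ isT pl) le1.
have /andP[_ bs] := base_two_expansionP bO m; rewrite zE in bs.
have : (2 * 2^-1 ^+ m <= weight R p)%R.
  rewrite /weight -(subnK pm) addnS exprS exprD mulrA divff ?pnatr_eq0 // mul1r.
  by rewrite ler_piMl ?exprn_ge0 ?exprn_ile1 ?invr_ge0 //; lra.
by lra.
Qed.
End Stages.

Lemma c_stage_ok e (A : encType) (z : nat) (m u s : A -> nat) :
  computable m -> computable u -> computable s ->
  computable (fun a => stage_ok e z (m a) (u a) (s a)).
Proof.
move=> cm cu cs; apply: c_leq.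
  apply: c_add; first exact: (c_mul (c_S cu) (c_exp2 cs)).
  exact: (c_mul (c_cst z) (c_mul (c_exp2 cm) (c_exp2 cs))).
apply: c_add; last exact: (c_mul (c_exp2 cm) (c_exp2 cs)).
apply: c_add; last exact: (c_exp2 cs).
apply: c_mul; last exact: (c_exp2 cm).
apply/c_sumn/(c_map (f := fun a q =>
   if halted e (s a) q then 2 ^ (s a - size (string_decode q)) else 0) (c_iota cs)).
have cs' := c_comp cs (@c_fst (pair_enc A nat_enc) A nat_enc _ c_id).
apply: c_if; [exact: (c_halted e cs' (c_snd c_id)) | | exact: (c_cst 0)].
apply/c_exp2/(c_sub cs')/c_size/c_string_decode; exact: (c_snd c_id).
Qed.

(** * The two directions *)

Lemma recfun_of_pair (e : recfun 1) : exists e2 : recfun 2, forall x y v,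
  rec_graph e [tuple npair x y] v -> rec_graph e2 [tuple x; y] v.
Proof.
have [ep epP] := rec2_npair.
exists (Comp e (fun=> ep)) => x y v xyv /=; exists [tuple npair x y] => //.
by move=> i; apply/epP; rewrite (tnth_nth 0) ord1.
Qed.

Lemma take_mkseq (T : Type) (b : nat -> T) m n : m <= n ->
  take m (mkseq b n) = mkseq b m.
Proof. by move=> mn; rewrite /mkseq -map_take take_iota (minn_idPl mn). Qed.

Lemma PfE (R : realType) (alpha : R) b s : base_two_expansion alpha b ->
  Pf alpha s <-> s = mkseq b (size s).
Proof.
move=> eb; split=> [[b' [n [eb' ->]]]|->]; last by exists b, (size s).
by rewrite size_mkseq; apply: eq_mkseq; apply: base_two_unique eb' eb.
Qed.

Section HaltingStage.
Variables (W : seq bool -> option (seq bool)) (e : recfun 1).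
Hypothesis eW : computes e W.

(** A machine with the domain of W whose values bound the running time of W. *)
Definition halting_stage : seq bool -> option (seq bool) :=
  search_machine (fun p s => halted e s (string_code p)) (fun _ s => string_decode s).

Lemma dom_halting_stage p : dom halting_stage p <-> dom W p.
Proof. by rewrite (computes_halted eW) dom_search_machine. Qed.

Lemma halting_stage_machine :
  prefix_free (dom W) -> prefix_free_machine halting_stage.
Proof.
move=> pf; split; last first.
  by move=> p q /dom_halting_stage pW /dom_halting_stage qW; apply: pf.
apply: search_machine_recursive.
  exact: (c_halted e (c_snd c_id) (c_string_code (c_fst c_id))).
exact: (c_string_decode (c_snd c_id)).
Qed.
End HaltingStage.

Section Sufficiency.
Variables (R : realType) (V W : seq bool -> option (seq bool)).
Hypotheses (optV : optimal V) (mW : prefix_free_machine W).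

Lemma reduction_exists : exists k,
  reducible_in_query_size (fun n => n + k) (dom W) (Pf (Omega R V)).
Proof.
have [[[eV eVP] pfV] univV] := optV.
have [[eW eWP] pfW] := mW.
have [d dP] := univV _ (halting_stage_machine eWP pfW).
have [b bO] := base_two_exists (Omega R V).
have [z zE] : exists z : nat, ((Num.floor (Omega R V))%:~R = z%:R :> R)%R.
  exists `|Num.floor (Omega R V)|%N.
  by rewrite natr_absz ger0_norm ?floor_ge0 ?Omega_ge0.
pose m u := size (string_decode u).
pose P w s := stage_ok eV z (m (nsnd w)) (nsnd w) s.
(* The value of V at q is the code of a stage by which W should stop at X. *)
pose witness X s q := if eval_upto eV s [:: q] is Some t then halted eW t X else false.
pose g w s : nat := has (witness (nfst w) s) (iota 0 s).
have c1 : computable (fun p : nat * nat => nfst p.1).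
  exact: (c_nat1 rec1_nfst (c_fst c_id)).
have c2 : computable (fun p : nat * nat => nsnd p.1).
  exact: (c_nat1 rec1_nsnd (c_fst c_id)).
have cP : computable (fun p : nat * nat => P p.1 p.2).
  exact: (c_stage_ok eV z (c_size (c_string_decode c2)) c2 (c_snd c_id)).
have cg : computable (fun p : nat * nat => g p.1 p.2).
  have cw : computable (fun p : nat * nat => has (witness (nfst p.1) p.2) (iota 0 p.2)).
    apply: (c_has (P := fun p => witness (nfst p.1) p.2) (c_iota (c_snd c_id))).
    apply: (c_ocase (g := fun (p : nat * nat * nat) t => halted eW t (nfst p.1.1))
      (c_app2 (f := eval_upto eV) (c_eval_upto eV) (c_snd (c_fst c_id))
        (c_cons (c_snd c_id) (c_cst [::])))
      (c_cst false)).
    apply: (c_halted eW (c_snd c_id)).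
    exact: (c_nat1 rec1_nfst (c_fst (c_fst (c_fst c_id)))).
  by have [r rr rP] := cw; exists r.
have [e eP] := search_recursive cP cg.
have [e2 e2P] := recfun_of_pair e.
(* One more bit than the length bound on q: [stage_complete] is about lengths < m. *)
exists d.+1; apply: (@oracle_machine e2 (dom W) (Pf (Omega R V)) b).
  move=> n; rewrite (PfE _ bO) size_rcons size_mkseq mkseqS.
  by split=> [/rcons_inj [<-]|->].
move=> x; apply/e2P/eP.
set w := npair _ _.
have w1 : nfst w = string_code x by rewrite nfst_pair.
have w2 : nsnd w = string_code (mkseq b (size x + d.+1)) by rewrite nsnd_pair.
have Pw s : P w s = stage_ok eV z (size x + d.+1) (string_code (mkseq b (size x + d.+1))) s.
  by rewrite /P /m w2 string_codeK size_mkseq.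
have exP : exists s, P w s.
  have [s sP] := stage_exists pfV eVP bO zE (size x + d.+1).
  by exists s; rewrite Pw.
case: (ex_minnP exP) => s Ps smin; exists s; split=> //.
  by move=> k ks; apply/negP => /smin; rewrite leqNgt ks.
congr nat_of_bool; rewrite /g w1; apply/asboolP/hasP => [xW|[q _]]; last first.
  rewrite /witness; case: (eval_upto eV s _) => [t|] // ht.
  by apply/(computes_halted eWP); exists t.
have [q [qV VF qx]] := dP x ((dom_halting_stage eWP x).2 xW).
have qs : q \in halted_by eV s.
  by apply: (stage_complete pfV eVP bO zE (m := size x + d.+1)); rewrite -?Pw //; lia.
move: qs; rewrite mem_halted_by => /andP[qs hq].
exists (string_code q); first by rewrite mem_iota.
move: hq; rewrite /witness /halted; case E: (eval_upto eV s _) => [t|] // _.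
have := VF; rewrite (computes_eval_upto eVP E) => /esym/search_machineP.
by move=> [t' [ht' _ /(can_inj string_decodeK) ->]].
Qed.
End Sufficiency.

Section Simulated.
Variable M : oracleTM.

Lemma halted_config (B : set (seq bool)) (x : seq bool) t t' a : t <= t' ->
  state_role (config_at M B x t).1 = Halt a ->
  config_at M B x t' = config_at M B x t.
Proof.
move=> /subnK <- ha; rewrite /config_at iterD -/(config_at M B x t).
by elim: (t' - t) => //= u ->; rewrite {1}/step ha.
Qed.

Lemma simulate_some s x t a : simulate M s x t = Some a <->
  state_role (config_at M [set u | prefix u s] x t).1 = Halt a.
Proof.
rewrite /simulate /halt_answer; case: (state_role _) => [c|q q'|delta]; split=> //.
  by move=> [->].
by move=> [->].
Qed.

Lemma simulate_mono s x t t' a : t <= t' ->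
  simulate M s x t = Some a -> simulate M s x t' = Some a.
Proof.
move=> tt' /simulate_some ha; apply/simulate_some.
by rewrite (halted_config tt' ha).
Qed.

(** Two oracles that agree on the queries actually made yield the same run. *)
Lemma config_at_prefix (B : set (seq bool)) s x :
  (forall u, size u <= size s -> B u <-> prefix u s) ->
  (forall u, queries M B x u -> size u <= size s) ->
  forall t, config_at M [set u | prefix u s] x t = config_at M B x t.
Proof.
move=> Bs qs; elim=> // t IH; rewrite /config_at !iterS -!/(config_at _ _ _ _) IH.
rewrite /step; case E: (state_role _) => [c|q q'|delta] //.
have sz : size (query_string (config_at M B x t)) <= size s.
  by apply: qs; exists t, q, q'.
suff -> : `[< ([set u | prefix u s]%classic : set (seq bool))
    (query_string (config_at M B x t)) >] =
  `[< B (query_string (config_at M B x t)) >] by [].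
by apply: asbool_equiv_eq; rewrite Bs.
Qed.
End Simulated.

Section Necessity.
Variables (R : realType) (V W : seq bool -> option (seq bool)) (f : nat -> nat).
Hypotheses (optW : optimal W) (f_mono : {homo f : m n / m <= n})
  (f_rec : total_recursive f).

Lemma rec1_total : rec1 f.
Proof.
have [e eP] := f_rec; exists e => xs y.
have -> : xs = [tuple nth 0 xs 0].
  by apply: eq_from_tnth => i; rewrite ord1 !(tnth_nth 0).
by rewrite -eP; split=> [->|->].
Qed.

Variables (M : oracleTM) (c : nat).
Hypotheses (Mred : reduces_via M (dom W) (Pf (Omega R V)))
  (Mq : forall x s, queries M (Pf (Omega R V)) x s -> size s <= f (size x) + c).
Hypothesis unbounded : forall k, exists n, f n + c + k.*2.+1 <= n.

(** The input length at which the k-th diagonalization takes place. *)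
Definition level k := ex_minn (unbounded k).

Lemma levelP k : f (level k) + c + k.*2.+1 <= level k.
Proof. by rewrite /level; case: ex_minnP. Qed.

Lemma c_level (A : encType) (k : A -> nat) : computable k ->
  computable (fun a => level (k a)).
Proof.
move=> ck; apply: (c_nat1 _ ck).
have cP : computable (fun p : nat * nat => f p.2 + c + p.1.*2.+1 <= p.2).
  apply: c_leq; last exact: (c_snd c_id).
  apply: c_add; last exact: (c_S (c_double (c_fst c_id))).
  exact: (c_add (c_nat1 rec1_total (c_snd c_id)) (c_cst c)).
have [e eP] := search_recursive (P := fun k n => f n + c + k.*2.+1 <= n)
  (g := fun _ n => n) cP (c_snd c_id).
exists e => xs y.
have -> : xs = [tuple nth 0 xs 0].
  by apply: eq_from_tnth => i; rewrite ord1 !(tnth_nth 0).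
rewrite eP /= /level; case: ex_minnP => n hn nmin; split=> [[t [ht lt ->]]|->].
  apply/eqP; rewrite eqn_leq nmin // andbT leqNgt; apply/negP => /lt.
  by rewrite hn.
by exists n; split=> // i ilt; apply/negP => /nmin; rewrite leqNgt ilt.
Qed.

Variable e : recfun 1.
Hypothesis eW : computes e W.

(** The number k of zeros before the first 1 in 0^k 1 s. *)
Definition header (p : seq bool) := find id p.
Definition payload p := drop (header p).+1 p.
Definition inputs p := iota 0 (2 ^ (level (header p)).+1).-1.

Definition simulated p t q :=
  if simulate M (payload p) (string_decode q) t is Some a
  then a ==> halted e t q else false.

Definition ready p t := [&& header p < size p,
  size (payload p) == f (level (header p)) + c & all (simulated p t) (inputs p)].

Definition output p t q :=
  if simulate M (payload p) (string_decode q) t is Some true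
  then odflt 0 (eval_upto e t [:: q]) else 0.

(** Its code exceeds that of every value of W found on an accepted input. *)
Definition fresh p t := string_decode (sumn [seq output p t q | q <- inputs p]).+1.

Definition diagonal : seq bool -> option (seq bool) := search_machine ready fresh.

Lemma c_header (A : encType) (p : A -> seq bool) : computable p ->
  computable (fun a => header (p a)).
Proof. by move=> cp; apply: (c_find (P := fun _ => id) cp (c_snd c_id)). Qed.

Lemma c_payload (A : encType) (p : A -> seq bool) : computable p ->
  computable (fun a => payload (p a)).
Proof. by move=> cp; apply: (c_drop (c_S (c_header cp)) cp). Qed.

Lemma c_inputs (A : encType) (p : A -> seq bool) : computable p ->
  computable (fun a => inputs (p a)).
Proof.
by move=> cp; apply: (c_iota (c_pred (c_exp2 (c_S (c_level (c_header cp)))))).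
Qed.

Lemma c_simulate_input : computable (fun w : seq bool * nat * nat =>
  simulate M (payload w.1.1) (string_decode w.2) w.1.2).
Proof.
apply: (c_comp (f := fun p : seq bool * seq bool * nat => simulate M p.1.1 p.1.2 p.2)
  (h := fun w : seq bool * nat * nat => ((payload w.1.1, string_decode w.2), w.1.2))).
  exact: c_simulate.
apply: (c_pair _ (c_snd (c_fst c_id))).
exact: (c_pair (c_payload (c_fst (c_fst c_id))) (c_string_decode (c_snd c_id))).
Qed.

Lemma c_ready : computable (fun w : seq bool * nat => ready w.1 w.2).
Proof.
have cp := @c_fst _ (seq_enc bool_enc) nat_enc _ c_id.
apply: (c_and (c_leq (c_S (c_header cp)) (c_size cp))); apply: c_and.
  apply: (c_eqn (c_size (c_payload cp))).
  exact: (c_add (c_nat1 rec1_total (c_level (c_header cp))) (c_cst c)).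
apply: (c_all (P := fun w => simulated w.1 w.2) (c_inputs cp)).
apply: (c_ocase (g := fun (w : seq bool * nat * nat) a => a ==> halted e w.1.2 w.2)
   c_simulate_input (c_cst false)).
apply: (@c_ext _ _ (fun u : seq bool * nat * nat * bool =>
  if u.2 then halted e u.1.1.2 u.1.2 else true)).
  by move=> [u []].
apply: (c_if (c_snd c_id) _ (c_cst true)).
exact: (c_halted e (c_snd (c_fst (c_fst c_id))) (c_snd (c_fst c_id))).
Qed.

Lemma c_fresh : computable (fun w : seq bool * nat => fresh w.1 w.2).
Proof.
apply/c_string_decode/c_S/c_sumn.
apply: (c_map (f := fun w => output w.1 w.2) (c_inputs (c_fst c_id))).
apply: (@c_ext _ _ (fun w : seq bool * nat * nat =>
   if simulate M (payload w.1.1) (string_decode w.2) w.1.2 is Some a then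
     (if a then (if eval_upto e w.1.2 [:: w.2] is Some y then y else 0) else 0) else 0)).
  by move=> w; rewrite /output; case: (simulate _ _ _ _) => [[]|].
apply: (c_ocase (g := fun (w : seq bool * nat * nat) (a : bool) => if a then
   (if eval_upto e w.1.2 [:: w.2] is Some y then y else 0) else 0) c_simulate_input (c_cst 0)).
apply: (c_if (c_snd c_id) _ (c_cst 0)).
apply: (c_ocase (g := fun _ y => y) _ (c_cst 0) (c_snd c_id)).
apply: (c_app2 (f := eval_upto e) (c_eval_upto e) (c_snd (c_fst (c_fst c_id)))).
exact: (c_cons (c_snd (c_fst c_id)) (c_cst [::])).
Qed.

(** The number of leading zeros determines the length of an input in the domain, so that no
    such input properly extends another. *)
Lemma diagonal_machine : prefix_free_machine diagonal.
Proof.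
split; first exact: search_machine_recursive c_ready c_fresh.
move=> p q /dom_search_machine [t /and3P[hp /eqP sp _]].
move=> /dom_search_machine [u /and3P[hq /eqP sq _]].
move=> /prefixP [r qE].
have hpq : header q = header p by rewrite qE /header find_cat has_find hp.
move: sp sq; rewrite /payload hpq !size_drop => sp sq.
rewrite hpq in hq; have sr : size q = size p + size r by rewrite [in LHS]qE size_cat.
have : size r = 0 by lia.
by move/size0nil => r0; rewrite qE r0 cats0.
Qed.

(** The optimality constant d of W for [diagonal] selects the level: the input 0^d 1 s, with
    s a prefix of Omega, is d bits shorter than [level d], so that W has a program of
    length at most [level d] for the fresh value. *)
Lemma bounded_queries_absurd : False.
Proof.
(* This constant is also the number of zeros in the input chosen below. *)
have [d dP] := (proj2 optW) _ diagonal_machine.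
have [b bO] := base_two_exists (Omega R V).
pose n := level d; pose s := mkseq b (f n + c).
pose p := nseq d false ++ true :: s.
have hp : header p = d.
  by rewrite /header find_cat has_nseq andbF /= addn0 size_nseq.
have pp : payload p = s.
  by rewrite /payload hp drop_cat size_nseq ltnNge leqnSn /= subSnn /= drop0.
have ss : size s = f n + c by rewrite size_mkseq.
have Bs u : size u <= size s -> Pf (Omega R V) u <-> prefix u s.
  by rewrite ss => us; rewrite (PfE _ bO) prefixE take_mkseq //; split=> [<-|/eqP->].
have simP x : size x <= n -> exists t, simulate M s x t = Some `[< dom W x >].
  move=> xn; have [t ht] := Mred x; exists t; apply/simulate_some.
  rewrite (@config_at_prefix _ (Pf (Omega R V))) // => u /Mq us.
  by rewrite ss; apply: leq_trans us _; rewrite leq_add2r; apply: f_mono.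
have inputP q : q \in inputs p -> size (string_decode q) <= n.
  by rewrite mem_iota /= add0n hp -string_code_size string_decodeK.
have [t rt] : exists t, ready p t.
  have [||t tP] := @uniform_stage 'I_((2 ^ n.+1).-1) (fun q t => simulated p t q).
  - move=> q t t' tt'; rewrite /simulated pp; case E: (simulate _ _ _ t) => [a|] //.
    rewrite (simulate_mono tt' E); case: a {E} => //=; exact: halted_mono.
  - move=> q; have qn : size (string_decode q) <= n.
      by rewrite -string_code_size string_decodeK.
    have [t ht] := simP _ qn; have [qW|qW] := pselect (dom W (string_decode q)).
      have /(computes_halted eW) [u hu] := qW; rewrite string_decodeK in hu.
      exists (maxn t u); rewrite /simulated pp (simulate_mono (leq_maxl t u) ht).
      by rewrite asboolT // (halted_mono (leq_maxr t u) hu).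
    by exists t; rewrite /simulated pp ht asboolF.
  exists t; apply/and3P; split; first by rewrite hp size_cat size_nseq /=; lia.
    by rewrite pp hp ss.
  apply/allP => q; rewrite mem_iota hp => /andP[_ qlt].
  exact: (tP (Ordinal qlt)).
have pD : dom diagonal p.
  by apply/dom_search_machine; exists t.
have [q [qW Wq qp]] := dP p pD.
have qn : size q <= n.
  apply: leq_trans qp _; rewrite size_cat size_nseq /= ss.
  by have := levelP d; rewrite -/n; lia.
case E: (diagonal p) pD => [y|] // _.
have /search_machineP [u [/and3P[_ _ /allP ru] _ yE]] := E.
have qin : string_code q \in inputs p by rewrite mem_iota hp /= add0n string_code_size.
have := ru _ qin; rewrite /simulated pp string_codeK.
case Es: (simulate M s q u) => [a|] // aq.
have aE : a = true.
  have [v hv] := simP q qn.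
  have := simulate_mono (leq_maxl u v) Es.
  rewrite (simulate_mono (leq_maxr u v) hv) => -[<-].
  exact: asboolT.
move: aq; rewrite aE /= /halted; case Eq: (eval_upto e u _) => [v|] // _.
have vy : v = string_code y.
  have := computes_eval_upto eW Eq; rewrite Wq E => -[->].
  by rewrite string_decodeK.
have : v <= sumn [seq output p u q' | q' <- inputs p].
  have -> : v = output p u (string_code q).
    by rewrite /output pp string_codeK Es aE Eq.
  rewrite sumnE big_map (bigD1_seq (string_code q)) ?iota_uniq //=.
  exact: leq_addr.
by rewrite vy yE string_decodeK ltnn.
Qed.
End Necessity.

Theorem theorem4p2 (R : realType) (V W : seq bool -> option (seq bool))
    (f : nat -> nat) (optV : optimal V) (optW : optimal W)
    (ordf : order_function f) :
  (exists c : nat,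
     reducible_in_query_size (fun n => (f n + c)%N) (dom W) (Pf (Omega R V)))
  <->
  (exists c : nat, forall n : nat, (n <= f n + c)%N).
Proof.
have [f_mono f_rec _] := ordf; split=> [[c [M [Mred Mq]]]|[c fc]].
  apply: contrapT => nc; have [[[e eW] _] _] := optW.
  apply: (@bounded_queries_absurd R V W f optW f_mono f_rec M c Mred Mq _ e eW).
  move=> k; apply: contrapT => nk; apply: nc; exists (c + k.*2.+1) => n.
  rewrite addnA leqNgt; apply/negP => lt; apply: nk; exists n; exact: ltnW.
have [k [M [Mred Mq]]] := reduction_exists R optV (proj1 optW).
exists (c + k); exists M; split=> // x s /Mq; rewrite addnA => /leq_trans; apply.
by rewrite leq_add2r.
Qed.
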